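(* There is a compact set $K\subset\mathbb{R}^2$ which is not intervally thin and such that for every function $f:\mathbb{R}^2\setminus K\to\mathbb{R}$ which is locally convex on $\mathbb{R}^2\setminus K$ there is a convex function $F:\mathbb{R}^2\to\mathbb{R}$ with $F=f$ on $\mathbb{R}^2\setminus K$.
   Context: $B(x,\varepsilon)$ is the open Euclidean ball with centre $x$ and radius $\varepsilon$; $[x,y]$ is the line segment with endpoints $x,y$. A set $A\subset\mathbb{R}^d$ is intervally thin if for any $x,y\in\mathbb{R}^d$ and any $\varepsilon>0$ there exist $x'\in B(x,\varepsilon)$ and $y'\in B(y,\varepsilon)$ such that $[x',y']\cap A=\emptyset$. For $U\subset\mathbb{R}^d$ open, a function $f:U\to\mathbb{R}$ is locally convex on $U$ if every point of $U$ has an open convex neighbourhood $V\subset U$ such that $f|_V$ is convex. *)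

(* Defs.v *)
From mathcomp Require Import all_boot all_order all_algebra.
From mathcomp Require Import all_classical all_reals all_analysis.

Set Implicit Arguments.
Unset Strict Implicit.
Unset Printing Implicit Defensive.

Import Order.TTheory GRing.Theory Num.Theory.
Import numFieldNormedType.Exports.

Local Open Scope classical_set_scope.
Local Open Scope ring_scope.

(* Points of R^d are row vectors. The norm carried by 'rV[R]_d in the library
   is the sup norm, so the Euclidean balls are defined explicitly; both norms
   induce the library's topology, to which [open] and [compact] refer. *)
Definition euclidean_ball (R : realType) (d : nat) (x : 'rV[R]_d) (e : R) :
    set 'rV[R]_d :=
  [set y | Num.sqrt (\sum_(i < d) (y 0 i - x 0 i) ^+ 2) < e].

Definition closed_segment (R : realType) (d : nat) (x y : 'rV[R]_d) :
    set 'rV[R]_d :=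
  [set (1 - t) *: x + t *: y | t in `[0, 1]].

Definition intervally_thin (R : realType) (d : nat) (A : set 'rV[R]_d) : Prop :=
  forall (x y : 'rV[R]_d) (e : R), 0 < e ->
    exists x' y' : 'rV[R]_d,
      [/\ euclidean_ball x e x', euclidean_ball y e y' &
          closed_segment x' y' `&` A = set0].

(* A function U -> R is represented by a total function of which only the
   values on U matter. *)
Definition locally_convex_on (R : realType) (d : nat) (U : set 'rV[R]_d)
    (f : 'rV[R]_d -> R) : Prop :=
  forall x : 'rV[R]_d, U x ->
    exists V : set 'rV[R]_d,
      [/\ open V, convex_set V, V x, V `<=` U & convex_function V f].

(* Main.v *)
Require Import Defs.
From mathcomp Require Import all_boot all_order all_algebra.
From mathcomp Require Import all_classical all_reals all_analysis.
From mathcomp Require Import ring lra zify.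

Import Order.TTheory GRing.Theory Num.Theory.
Import numFieldNormedType.Exports.

Set Implicit Arguments.
Unset Strict Implicit.
Unset Printing Implicit Defensive.

Local Open Scope classical_set_scope.
Local Open Scope ring_scope.

(** The set is [K = C x C], where [C] is the Cantor set of the numbers
[\sum_k d_k 6^-k], [k >= 1], with digits [d_k] in {-1, 0, 1}.

It is not intervally thin because [C + tC] is a whole interval for every [t] in
[2, 5/2]: one step of the construction offers the nine values [d + t e], whose
gaps are short enough for the recursion to go on. Hence all lines
[x + t y = c] with [c] small meet [K] ([cantor_set_cover]), and these contain
all segments between two small balls ([not_thin_cantor_square]).

On the other hand the sets [C], [C + C] and [C - C] have digits in {-2, ..., 2},
five of them in base 6, so that they are null sets: [K] has null projections
along the four directions (1, 0), (0, 1), (1, 1) and (1, -1). If [f] is locally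
convex off [K], then it is convex on almost all lines of these directions, since
they miss [K]. Two consequences follow.

- [f] is Lipschitz off [K] on bounded boxes ([lip_off_square]), so it has a
  continuous extension [F] ([extend_to_square]), and [F] is convex on all lines
  of the four directions ([extension_axes]).

- The second derivative of [F] in each of the four directions is a nonnegative
  measure, and it does not charge [K], because along the direction it is made of
  one-dimensional measures of bounded mass and the projection of [K] is null.
  Polarisation writes the mixed derivative as a combination of the derivatives
  in the two diagonal directions, so the whole Hessian measure gives no mass to
  [K]; off [K] it is positive semidefinite, and therefore [F] is convex.

The second argument is carried out with second differences on the lattice of mesh
[6^-n] instead of measures. At a lattice point far from [K] the second difference
in the direction of a lattice vector [w] is nonnegative; at the other points it is
bounded below by minus a sum of diagonal second differences
([second_diff_ge_diagonals]). Along one diagonal these sums telescope, and only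
[O(5^n)] diagonals come near [K], so that the total defect in a window is
[O((5/6)^n)] ([diagonal_sum], [near_sums_count], [window_sum]). Summing along a
segment and averaging over translations of it yields midpoint convexity in the
limit ([second_diff_approx], [second_diff_ge0]). *)

(** * Convexity on an interval *)

Definition convex_between (R : realType) (phi : R -> R) (a b : R) :=
  forall x z t : R, a <= x <= b -> a <= z <= b -> 0 <= t <= 1 ->
    phi ((1 - t) * x + t * z) <= (1 - t) * phi x + t * phi z.

Lemma continuous_of_lip (R : realType) (phi : R -> R) (x e k : R) : 0 < e -> 
  (forall s, `|s - x| < e -> `|phi s - phi x| <= k * `|s - x|) -> {for x, continuous phi}.
Proof.
move=> e0 H; apply/cvgrPdist_le => d d0; near=> s.
have sx : `|s - x| < e.
  by rewrite distrC; near: s; exact: (@cvgr_dist_lt _ _ _ (nbhs x) _ id x).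
have sx2 : `|s - x| < d / (`|k| + 1).
  rewrite distrC; near: s; apply: (@cvgr_dist_lt _ _ _ (nbhs x) _ id x) => //.
  by rewrite divr_gt0// ltr_wpDl.
rewrite distrC (le_trans (H _ sx))//.
have k1 : 0 < `|k| + 1 by rewrite ltr_wpDl.
rewrite (@le_trans _ _ ((`|k| + 1) * `|s - x|))//.
  apply: ler_wpM2r => //; apply: (le_trans (ler_norm k)); lra.
by rewrite mulrC -ler_pdivlMr// ltW.
Unshelve. all: by end_near. Qed.

(** Subtract from [phi] its chord and the small concave function [eta (t - a) (b - t)].
If [phi] exceeds the chord somewhere, the difference has an interior maximum, where
the midpoint inequality fails by [2 eta s^2]. One step [s] at each point suffices. *)
Lemma chord_of_midpoints (R : realType) (phi : R -> R) (a b : R) :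
  (forall t, a <= t <= b -> {for t, continuous phi}) ->
  (forall c, a < c < b -> exists2 s, [/\ 0 < s, a <= c - s & c + s <= b] &
     2 * phi c <= phi (c - s) + phi (c + s)) ->
  forall x, a <= x <= b ->
    (b - a) * phi x <= (b - x) * phi a + (x - a) * phi b.
Proof.
move=> cphi mid x /andP[ax xb]; rewrite leNgt; apply/negP => viol.
have ltax : a < x.
  by rewrite lt_neqAle ax andbT; apply/eqP => E; move: viol; rewrite E; lra.
have ltxb : x < b.
  by rewrite lt_neqAle xb andbT; apply/eqP => E; move: viol; rewrite E; lra.
set d := (b - a) * phi x - ((b - x) * phi a + (x - a) * phi b).
have d0 : 0 < d by rewrite /d subr_gt0.
(* With this [eta] half of the violation [d] at [x] is left in [psi x]. *)
set eta := d / (2 * ((x - a) * (b - x))).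
have p0 : 0 < (x - a) * (b - x) by rewrite mulr_gt0 ?subr_gt0.
have eta0 : 0 < eta by rewrite divr_gt0// mulr_gt0.
pose psi (t : R) := (b - a) * phi t -
  ((b - t) * phi a + (t - a) * phi b + eta * ((t - a) * (b - t))).
have psix : psi x = d / 2.
  rewrite /psi [eta * _](_ : _ = d / 2); first by rewrite {2}/d; rewrite -/d /d; field.
  by rewrite /eta; field; apply/andP; split; apply: lt0r_neq0; rewrite subr_gt0.
have : {within `[a, b], continuous psi}.
  apply: (continuous_in_subspaceT (A := `[a, b])) => t.
  rewrite inE/= in_itv/= => tab.
  have ct := cphi t tab.
  have cid : {for t, continuous (fun t : R => t)} by [].
  have cst (u : R) : {for t, continuous (fun _ : R => u)} by exact: cvg_cst.
  apply: (@continuousB _ _ _ (fun t => (b - a) * phi t)).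
    exact: (@continuousM _ _ (fun=> b - a)).
  apply: (@continuousD _ _ _ (fun t => (b - t) * phi a + (t - a) * phi b)).
    apply: (@continuousD _ _ _ (fun t => (b - t) * phi a)).
      apply: (@continuousM _ _ (fun t => b - t)) => //.
      exact: (@continuousB _ _ _ (fun=> b)).
    apply: (@continuousM _ _ (fun t => t - a)) => //.
    exact: (@continuousB _ _ _ (fun t => t)).
  apply: (@continuousM _ _ (fun=> eta)) => //.
  apply: (@continuousM _ _ (fun t => t - a)) => //.
    exact: (@continuousB _ _ _ (fun t => t)).
  exact: (@continuousB _ _ _ (fun=> b)).
have ab : a <= b by apply: le_trans xb.
move=> /(EVT_max ab)[c]; rewrite in_itv/= => /andP[ac cb] cmax.
have pc : 0 < psi c.
  apply: lt_le_trans (cmax x _); first by rewrite psix divr_gt0.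
  by rewrite in_itv/= ax.
have ltac : a < c.
  by rewrite lt_neqAle ac andbT; apply/eqP => E; move: pc; rewrite /psi E; lra.
have ltcb : c < b.
  by rewrite lt_neqAle cb andbT; apply/eqP => E; move: pc; rewrite /psi E; lra.
have [|s [s0 as_ sb] hs] := mid c; first by rewrite ltac.
have h1 : psi (c - s) <= psi c.
  by apply: cmax; rewrite in_itv/= as_/=; apply: le_trans sb; lra.
have h2 : psi (c + s) <= psi c.
  by apply: cmax; rewrite in_itv/= sb andbT; apply: le_trans as_ _; lra.
have h3 : 0 < 2 * (eta * s ^+ 2) by rewrite mulr_gt0// mulr_gt0// exprn_gt0.
have h4 : (b - a) * (2 * phi c) <= (b - a) * (phi (c - s) + phi (c + s)).
  by rewrite ler_wpM2l// subr_ge0.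
have h5 : psi (c - s) + psi (c + s) - 2 * psi c =
  (b - a) * (phi (c - s) + phi (c + s)) - (b - a) * (2 * phi c) + 2 * (eta * s ^+ 2).
  by rewrite /psi; ring.
lra.
Qed.

Lemma convex_of_midpoints (R : realType) (phi : R -> R) (a b : R) :
  (forall t, a <= t <= b -> {for t, continuous phi}) ->
  (forall c, a < c < b -> exists2 e : R, 0 < e & forall s, 0 < s < e ->
     2 * phi c <= phi (c - s) + phi (c + s)) ->
  convex_between phi a b.
Proof.
move=> cphi mid.
have key x z t : x < z -> a <= x <= b -> a <= z <= b -> 0 <= t <= 1 ->
    phi ((1 - t) * x + t * z) <= (1 - t) * phi x + t * phi z.
  move=> xz /andP[ax xb] /andP[az zb] /andP[t0 t1].
  have zx0 : 0 < z - x by lra.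
  set y := (1 - t) * x + t * z.
  have -> : t = (y - x) / (z - x) by rewrite /y; field; lra.
  have -> : 1 - (y - x) / (z - x) = (z - y) / (z - x) by field; lra.
  have -> : (z - y) / (z - x) * phi x + (y - x) / (z - x) * phi z =
      ((z - y) * phi x + (y - x) * phi z) / (z - x) by ring.
  rewrite ler_pdivlMr// mulrC; apply: chord_of_midpoints.
  - by move=> u /andP[xu uz]; apply: cphi; lra.
  - move=> c /andP[xc cz].
    have [|e e0 he] := mid c; first lra.
    pose s := Order.min (e / 2) (Order.min (c - x) (z - c)).
    have s0 : 0 < s by rewrite /s !lt_min; apply/and3P; split; lra.
    have : s <= s by [].
    rewrite {2}/s !le_min => /and3P[se sc sz].
    exists s; first by split => //; lra.
    apply: he; lra.
  - have ttx : 0 <= t * (z - x) by rewrite mulr_ge0// ltW.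
    have ttx' : 0 <= (1 - t) * (z - x) by rewrite mulr_ge0// ?subr_ge0// ltW.
    rewrite /y; lra.
move=> x z t xab zab tab.
have [xz|zx|->] := ltgtP x z; first exact: key.
  have -> : (1 - t) * x + t * z = (1 - (1 - t)) * z + (1 - t) * x by ring.
  have -> : (1 - t) * phi x + t * phi z =
    (1 - (1 - t)) * phi z + (1 - t) * phi x by ring.
  by apply: key => //; lra.
by rewrite -!mulrDl subrK !mul1r.
Qed.

Definition convex_near (R : realType) (phi : R -> R) (t : R) :=
  exists2 e : R, 0 < e & convex_between phi (t - e) (t + e).

(** Chords bound the increments of [phi] at [t] from above, and the midpoint inequality
turns this into a lower bound. *)
Lemma convex_near_continuous (R : realType) (phi : R -> R) (t : R) :
  convex_near phi t -> {for t, continuous phi}.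
Proof.
case=> e e0 H.
pose k := (`|phi (t - e) - phi t| + `|phi (t + e) - phi t|) / e.
have en0 : e != 0 by rewrite gt_eqF.
have up1 l : 0 <= l <= 1 -> phi (t + l * e) - phi t <= l * (phi (t + e) - phi t).
  move=> l01; have := H t (t + e) l.
  have -> : (1 - l) * t + l * (t + e) = t + l * e by ring.
  by move=> /(_ ltac:(lra) ltac:(lra) l01); lra.
have up2 l : 0 <= l <= 1 -> phi (t - l * e) - phi t <= l * (phi (t - e) - phi t).
  move=> l01; have := H t (t - e) l.
  have -> : (1 - l) * t + l * (t - e) = t - l * e by ring.
  by move=> /(_ ltac:(lra) ltac:(lra) l01); lra.
have mid l : 0 <= l <= 1 -> 2 * phi t <= phi (t - l * e) + phi (t + l * e).
  move=> /andP[l0 l1].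
  have le0 : 0 <= l * e by rewrite mulr_ge0// ltW.
  have le1 : l * e <= e by rewrite ler_piMl// ltW.
  have := H (t - l * e) (t + l * e) (1 / 2).
  have -> : (1 - 1 / 2) * (t - l * e) + 1 / 2 * (t + l * e) = t by field.
  by move=> /(_ ltac:(lra) ltac:(lra) ltac:(lra)); lra.
apply: (@continuous_of_lip _ _ _ e k) => // s se.
pose l := `|s - t| / e.
have l0 : 0 <= l by rewrite divr_ge0// ltW.
have l1 : l <= 1 by rewrite ler_pdivrMr// mul1r ltW.
have lE : `|s - t| = l * e by rewrite /l divfK.
have l01 : 0 <= l <= 1 by rewrite l0.
have b1 := up1 l l01; have b2 := up2 l l01; have b3 := mid l l01.
have n1 : l * (phi (t + e) - phi t) <= l * `|phi (t + e) - phi t|.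
  by rewrite ler_wpM2l// ler_norm.
have n2 : l * (phi (t - e) - phi t) <= l * `|phi (t - e) - phi t|.
  by rewrite ler_wpM2l// ler_norm.
have n3 : 0 <= l * `|phi (t + e) - phi t| by rewrite mulr_ge0.
have n4 : 0 <= l * `|phi (t - e) - phi t| by rewrite mulr_ge0.
rewrite lE.
have -> : k * (l * e) = l * `|phi (t + e) - phi t| + l * `|phi (t - e) - phi t|.
  by rewrite /k; field.
have [st|st] := leP t s.
  have -> : s = t + l * e by rewrite -lE ger0_norm ?subr_ge0//; ring.
  by rewrite ler_norml; apply/andP; split; lra.
have -> : s = t - l * e by rewrite -lE ltr0_norm ?subr_lt0//; ring.
by rewrite ler_norml; apply/andP; split; lra.
Qed.

(** Local convexity on a segment is convexity, through the continuity and the midpoint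
inequality for small steps that it provides. *)
Lemma convex_near_between (R : realType) (phi : R -> R) (a b : R) :
  (forall t, a <= t <= b -> convex_near phi t) -> convex_between phi a b.
Proof.
move=> H; apply: convex_of_midpoints => [t /H|c /andP[ac cb]].
  exact: convex_near_continuous.
have [|e e0 he] := H c; first lra.
exists e => // s /andP[s0 se].
have := he (c - s) (c + s) (1 / 2).
have -> : (1 - 1 / 2) * (c - s) + 1 / 2 * (c + s) = c by field.
by move=> /(_ ltac:(lra) ltac:(lra) ltac:(lra)); lra.
Qed.

(** * Cantor sets in base 6 *)

(** The approximations of level [n]: the points of [-b/5, b/5] whose first [n] digits in
base 6 can be taken in {-b, ..., b}. The parameter [b] is 1 for the set itself and 2
for its sums and differences. *)
Fixpoint cantor (R : realType) (b n : nat) (x : R) : Prop :=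
  if n is n'.+1 then exists d : 'I_(b.*2.+1), cantor b n' (6 * x - (d%:R - b%:R))
  else `|x| <= b%:R / 5.

Definition cantor_set (R : realType) (b : nat) : set R :=
  [set x | forall n, cantor b n x].

Lemma digit_le (R : realType) (b : nat) (d : 'I_(b.*2.+1)) :
  `|d%:R - b%:R| <= b%:R :> R.
Proof.
have h : (d <= 2 * b)%N by rewrite mul2n -ltnS ltn_ord.
have h2 : d%:R <= 2 * b%:R :> R by rewrite -natrM ler_nat.
have h0 : 0 <= d%:R :> R by [].
by rewrite ler_norml; apply/andP; split; lra.
Qed.

Lemma cantorS (R : realType) (b n : nat) (x : R) : cantor b n.+1 x -> cantor b n x.
Proof.
elim: n x => [x [d]|n IH x [d /IH hd]] /=; last by exists d.
have := digit_le R d; rewrite !ler_norml => /andP[? ?] /andP[? ?].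
by apply/andP; split; lra.
Qed.

Lemma cantorW (R : realType) (b n m : nat) (x : R) :
  (m <= n)%N -> cantor b n x -> cantor b m x.
Proof.
elim: n m x => [|n IH] m x; first by rewrite leqn0 => /eqP ->.
by rewrite leq_eqVlt ltnS => /orP[/eqP -> //|mn /cantorS/IH]; exact.
Qed.

Lemma cantor_norm (R : realType) (b n : nat) (x : R) :
  cantor b n x -> `|x| <= b%:R / 5.
Proof. by move=> /(cantorW (leq0n n)). Qed.

Lemma continuous_affine (R : realType) (p q : R) : continuous (fun x : R => p + q * x).
Proof.
by move=> x; apply: cvgD; [exact: cvg_cst|apply: cvgM; [exact: cvg_cst|exact: cvg_id]].
Qed.

Lemma closed_cantor (R : realType) (b n : nat) : closed [set x : R | cantor b n x].
Proof.
elim: n => [|n IH] /=.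
  rewrite (_ : [set x | _] = [set` `[- (b%:R / 5) : R, b%:R / 5]]).
    exact: interval_closed.
  by apply/seteqP; split => x /=; rewrite in_itv/= ler_norml.
rewrite (_ : [set x | _] =
  \bigcup_(d in [set: 'I_(b.*2.+1)])
     (fun x : R => 6 * x - (d%:R - b%:R)) @^-1` [set x | cantor b n x]).
  apply: closed_bigcup => [|d _]; first exact: finite_finset.
  rewrite (_ : (fun x => _) = fun x : R => - (d%:R - b%:R) + 6 * x).
    by apply: preimage_closed => // x _; exact: continuous_affine.
  by apply/funext => x; rewrite addrC.
by apply/seteqP; split => x /= [d]; [exists d | move=> _ ?; exists d].
Qed.

Lemma closed_cantor_set (R : realType) (b : nat) : closed (@cantor_set R b).
Proof.
rewrite (_ : cantor_set b = \bigcap_(n in setT) [set x : R | cantor b n x]).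
  by apply: closed_bigI => n _; exact: closed_cantor.
by apply/seteqP; split => x /= h n *; exact: h.
Qed.

Lemma cantorD (R : realType) (n : nat) (x y : R) :
  cantor 1 n x -> cantor 1 n y -> cantor 2 n (x + y).
Proof.
elim: n x y => [|n IH] x y /=.
  by move=> hx hy; rewrite (le_trans (ler_normD _ _))//; lra.
move=> [[d hd] hx] [[e he] hy].
have de : (d + e < 5)%N by move: (hd) (he); lia.
exists (Ordinal de) => /=.
have -> : 6 * (x + y) - ((d + e)%:R - 2) =
    6 * x - (d%:R - 1) + (6 * y - (e%:R - 1)) by rewrite natrD; ring.
exact: IH.
Qed.

Lemma cantorN (R : realType) (n : nat) (x : R) : cantor 1 n x -> cantor 1 n (- x).
Proof.
elim: n x => [|n IH] x /=; first by rewrite normrN.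
move=> [[d hd] /IH /= hx].
have de : (2 - d < 3)%N by move: (hd); lia.
exists (Ordinal de) => /=; rewrite natrB; last by move: (hd); lia.
by have -> : 6 * (- x) - (2 - d%:R - 1) = - (6 * x - (d%:R - 1)) by ring.
Qed.

Lemma cantor12 (R : realType) (n : nat) (x : R) : cantor 1 n x -> cantor 2 n x.
Proof.
elim: n x => [|n IH] x /=; first by move=> /le_trans; apply; lra.
move=> [[d hd] /IH hx].
have de : (d + 1 < 5)%N by move: (hd); lia.
exists (Ordinal de) => /=.
by have -> : 6 * x - ((d + 1)%:R - 2) = 6 * x - (d%:R - 1) by rewrite natrD; ring.
Qed.

(** For [b <= 2] the scaled point stays away from the half-integers, which makes gaps of
relative size at least 1/5 at all scales. *)
Lemma cantor_near_int (R : realType) (b n : nat) (x : R) : cantor b n x ->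
  exists k : int, `|6 ^+ n * x - k%:~R| <= b%:R / 5.
Proof.
elim: n x => [|n IH] x /=; first by exists 0; rewrite expr0 mul1r subr0.
move=> [d /IH[k hk]]; exists (k + 6 ^+ n * (d%:Z - b%:Z)).
suff -> : 6 ^+ n.+1 * x - (k + 6 ^+ n * (d%:Z - b%:Z))%:~R =
    6 ^+ n * (6 * x - (d%:R - b%:R)) - k%:~R :> R by [].
have -> : (k + 6 ^+ n * (d%:Z - b%:Z))%:~R = k%:~R + 6 ^+ n * (d%:R - b%:R) :> R.
  by rewrite intrD intrM intrB rmorphXn/= !pmulrn.
by rewrite exprS; ring.
Qed.

Lemma exists_pow_lt (R : realType) (e : R) : 0 < e -> exists n, (6 ^+ n)^-1 < e.
Proof.
move=> e0; pose n := Num.truncn e^-1; exists n.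
rewrite invf_plt ?posrE ?exprn_gt0//.
have /andP[_ h] := truncn_itv (ltW (etrans (invr_gt0 e) e0)).
apply: lt_le_trans h _; rewrite -/n -natrX ler_nat.
exact: ltn_expl.
Qed.

Lemma cantor_set_dense (R : realType) (x e : R) : 0 < e ->
  exists2 y, `|y - x| < e & ~ cantor_set 2 y.
Proof.
move=> /exists_pow_lt[n hn].
have p0 : 0 < 6 ^+ n :> R by rewrite exprn_gt0.
have pn0 : 6 ^+ n != 0 :> R by rewrite gt_eqF.
pose k := Num.floor (6 ^+ n * x).
have /andP[k1 k2] := floor_itv (6 ^+ n * x).
rewrite -/k in k1 k2.
rewrite intrD in k2.
(* The nearest half-integer at scale [6^-n] lies in a gap. *)
exists ((k%:~R + 1 / 2) / 6 ^+ n).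
  apply: le_lt_trans hn.
  have -> : (k%:~R + 1 / 2) / 6 ^+ n - x = (k%:~R + 1 / 2 - 6 ^+ n * x) / 6 ^+ n.
    by field.
  rewrite normrM (gtr0_norm (x := _^-1)) ?invr_gt0//.
  rewrite -[leRHS]mul1r ler_wpM2r ?invr_ge0 ?ltW//.
  by rewrite ltr_norml; apply/andP; split; lra.
move=> /(_ n)/cantor_near_int[j].
rewrite mulrC divfK//.
have -> : k%:~R + 1 / 2 - j%:~R = (k - j)%:~R + 1 / 2 :> R by rewrite rmorphB/=; ring.
move: (k - j) => i; rewrite ler_norml => /andP[h1 h2].
have : (i%:~R < 0 :> R) by lra.
have : (-1 < i%:~R :> R) by lra.
rewrite ltrz0 (_ : -1 = (-1)%:~R)// ltr_int; lia.
Qed.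

(** For [2 <= t <= 5/2] the nine numbers [d + t e] lie in
the order -1-t, -t, 1-t, -1, 0, 1, t-1, t, t+1, with gaps at most 1, whereas an
interval of radius [(1 + t) / 5] has length more than 1. So every admissible [6 c] is
within that radius of one of them. *)
Lemma cantor_cover_level (R : realType) (t : R) (n : nat) (c : R) :
  2 <= t <= 5 / 2 -> `|c| <= (1 + t) / 5 ->
  exists x y, [/\ cantor 1 n x, cantor 1 n y & x + t * y = c].
Proof.
move=> /andP[t2 t3]; elim: n c => [|n IH] c; rewrite ler_norml => /andP[c1 c2].
  have t0 : 1 + t != 0 by rewrite gt_eqF; lra.
  exists (c / (1 + t)), (c / (1 + t)) => /=.
  have hc : `|c / (1 + t)| <= 1 / 5.
    rewrite normrM normfV (gtr0_norm (x := 1 + t)); last lra.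
    by rewrite ler_pdivrMr; [rewrite ler_norml; apply/andP; split; lra|lra].
  by split => //; field.
have key (d e : 'I_3) : `|6 * c - (d%:R - 1 + t * (e%:R - 1))| <= (1 + t) / 5 ->
    exists x y, [/\ cantor 1 n.+1 x, cantor 1 n.+1 y & x + t * y = c].
  move=> /IH[x [y [hx hy xyE]]].
  exists ((x + (d%:R - 1)) / 6), ((y + (e%:R - 1)) / 6); split => /=.
  - by exists d; rewrite (_ : 6 * _ - _ = x)//; field.
  - by exists e; rewrite (_ : 6 * _ - _ = y)//; field.
  - have -> : c = (x + t * y + (d%:R - 1 + t * (e%:R - 1))) / 6 by rewrite xyE; field.
    by field.
have D d e (hd : (d < 3)%N) (he : (e < 3)%N) := key (Ordinal hd) (Ordinal he).
have [h1|h1] := leP (6 * c) (- t - 1 / 2).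
  by apply: (D 0 0)%N => //=; rewrite ler_norml; apply/andP; split; lra.
have [h2|h2] := leP (6 * c) (- t + 1 / 2).
  by apply: (D 1 0)%N => //=; rewrite ler_norml; apply/andP; split; lra.
have [h3|h3] := leP (6 * c) (- t / 2).
  by apply: (D 2 0)%N => //=; rewrite ler_norml; apply/andP; split; lra.
have [h4|h4] := leP (6 * c) (- 1 / 2).
  by apply: (D 0 1)%N => //=; rewrite ler_norml; apply/andP; split; lra.
have [h5|h5] := leP (6 * c) (1 / 2).
  by apply: (D 1 1)%N => //=; rewrite ler_norml; apply/andP; split; lra.
have [h6|h6] := leP (6 * c) (t / 2).
  by apply: (D 2 1)%N => //=; rewrite ler_norml; apply/andP; split; lra.
have [h7|h7] := leP (6 * c) (t - 1 / 2).
  by apply: (D 0 2)%N => //=; rewrite ler_norml; apply/andP; split; lra.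
have [h8|h8] := leP (6 * c) (t + 1 / 2).
  by apply: (D 1 2)%N => //=; rewrite ler_norml; apply/andP; split; lra.
by apply: (D 2 2)%N => //=; rewrite ler_norml; apply/andP; split; lra.
Qed.

(** A cluster point of the solutions at the finite levels solves at all levels, since the
levels are closed and decreasing. *)
Lemma cantor_set_cover (R : realType) (t c : R) :
  2 <= t <= 5 / 2 -> `|c| <= (1 + t) / 5 ->
  exists x y, [/\ cantor_set 1 x, cantor_set 1 y & x + t * y = c].
Proof.
move=> ht hc.
have /choice[u hu] : forall n, exists y, cantor 1 n (c - t * y) /\ cantor 1 n y.
  move=> n; have [x [y [hx hy <-]]] := cantor_cover_level n ht hc.
  by exists y; rewrite addrK.
have cpt : compact [set` `[- (1 / 5) : R, 1 / 5]] by exact: segment_compact.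
have [|y [_ clu]] := cpt (u @ \oo) _.
  exists 0 => // n _ /=; rewrite in_itv/= -ler_norml.
  by have [_ /cantor_norm] := hu n.
have lim n : cantor 1 n (c - t * y) /\ cantor 1 n y.
  rewrite -mulNr.
  have cl : closed ((fun y : R => c + (- t) * y) @^-1` [set x | cantor 1 n x] `&`
                    [set x | cantor 1 n x]).
    apply: closedI; last exact: closed_cantor.
    apply: preimage_closed; last exact: closed_cantor.
    by move=> x _; exact: continuous_affine.
  apply: cl => B By; apply: clu => //.
  exists n => // k /= nk; have [h1 h2] := hu k.
  by split => /=; rewrite ?mulNr; apply: (cantorW nk).
exists (c - t * y), y; split => [n|n|]; first by have [] := lim n.
  by have [] := lim n.
by rewrite subrK.
Qed.

(** * The square of the Cantor set is compact and not intervally thin *)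

Definition cantor_square (R : realType) : set 'rV[R]_2 :=
  [set v | forall i, cantor_set 1 (v ord0 i)].

Lemma compact_cantor_square (R : realType) : compact (@cantor_square R).
Proof.
apply: (@rV_compact R 2 (fun=> cantor_set 1)) => _.
apply: subclosed_compact (@closed_cantor_set R 1) (@segment_compact R (- (1 / 5)) (1 / 5)) _.
by move=> x /(_ 0) /=; rewrite in_itv/= ler_norml.
Qed.

Lemma euclidean_ball_coord (R : realType) (d : nat) (x y : 'rV[R]_d) (e : R) i :
  euclidean_ball x e y -> `|y 0 i - x 0 i| < e.
Proof.
apply: le_lt_trans; rewrite -sqrtr_sqr ler_wsqrtr//.
by rewrite (bigD1 i)//= lerDl sumr_ge0// => j _; exact: sqr_ge0.
Qed.

(** The segments between the balls of radius 1/20 around (-9/4, 1) and (9/4, -1) lie on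
lines [x + t y = c] with [t] in [2, 5/2] and [c] small, and they cross the strip
[|y| <= 1/5] that contains the square. *)
Lemma not_thin_cantor_square (R : realType) : ~ intervally_thin (@cantor_square R).
Proof.
pose p : 'rV[R]_2 := \row_i (if i == 0 then - (9 / 4) else 1).
move=> /(_ p (- p) (1 / 20)) [|x [y [hx hy]]]; first by rewrite divr_gt0.
have := euclidean_ball_coord 0 hx; have := euclidean_ball_coord 1 hx.
have := euclidean_ball_coord 0 hy; have := euclidean_ball_coord 1 hy.
rewrite !mxE/= !ltr_norml.
set a1 := x 0 0; set a2 := x 0 1; set b1 := y 0 0; set b2 := y 0 1.
move=> /andP[? ?] /andP[? ?] /andP[? ?] /andP[? ?].
have d0 : 0 < a2 - b2 by lra.
pose t := (b1 - a1) / (a2 - b2).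
have t1 : 2 <= t by rewrite ler_pdivlMr//; lra.
have t2 : t <= 5 / 2 by rewrite ler_pdivrMr//; lra.
have [|| u [v [Cu Cv uv]]] := @cantor_set_cover R t (a1 + t * a2).
- by rewrite t1.
- have tE : t * (a2 - b2) = b1 - a1 by rewrite divfK// gt_eqF.
  by rewrite ler_norml; apply/andP; split; nra.
have := cantor_norm (Cv 0%N); rewrite ler_norml => /andP[? ?].
pose s := (a2 - v) / (a2 - b2).
have s0 : 0 <= s by rewrite divr_ge0//; lra.
have s1 : s <= 1 by rewrite ler_pdivrMr//; lra.
rewrite -subset0 => /(_ ((1 - s) *: x + s *: y)); apply; split.
  by exists s => //=; rewrite in_itv/= s0.
have dn0 : a2 - b2 != 0 by rewrite gt_eqF.
move=> i; rewrite !mxE; case: i => -[|[|//]] hi.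
- rewrite (_ : Ordinal hi = 0); last exact/val_inj.
  rewrite -/a1 -/b1 (_ : _ + _ = u)// (_ : u = a1 + t * a2 - t * v) ?uv; last by rewrite -uv; ring.
  by rewrite /s /t; field.
- rewrite (_ : Ordinal hi = 1); last exact/val_inj.
  by rewrite -/a2 -/b2 (_ : _ + _ = v)// /s; field.
Qed.

(** * Lipschitz bounds off the square *)

Lemma ler_of_eps (R : realType) (a b k : R) : 0 <= k ->
  (forall e : R, 0 < e < 1 -> a <= b + k * e) -> a <= b.
Proof.
move=> k0 H; rewrite leNgt; apply/negP => ba.
pose e := Order.min (1 / 2) ((a - b) / (2 * (k + 1))).
have p1 : 0 < 2 * (k + 1) by lra.
have e0 : 0 < e by rewrite /e lt_min divr_gt0//= divr_gt0// subr_gt0.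
have : e <= e by [].
rewrite {2}/e le_min => /andP[e1 e2].
have := H e; rewrite e0 (le_lt_trans e1)/=; last lra.
move=> /(_ isT) h.
have : e * (2 * (k + 1)) <= a - b by rewrite -ler_pdivlMr.
lra.
Qed.

Lemma convex_chord (R : realType) (phi : R -> R) (a b x y z : R) :
  convex_between phi a b -> a <= x -> x <= y -> y <= z -> z <= b ->
  (z - x) * phi y <= (z - y) * phi x + (y - x) * phi z.
Proof.
move=> H ax xy yz zb.
have [xz|zx] := ltP x z; last first.
  have -> : y = x by lra.
  have -> : z = x by lra.
  by rewrite subrr !mul0r addr0.
have p : 0 < z - x by rewrite subr_gt0.
have pn : z - x != 0 by rewrite gt_eqF.
pose t := (y - x) / (z - x).
have t0 : 0 <= t by rewrite divr_ge0 ?subr_ge0// ltW.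
have t1 : t <= 1 by rewrite ler_pdivrMr//; lra.
have := H x z t; rewrite (_ : (1 - t) * x + t * z = y); last by rewrite /t; field.
move=> /(_ ltac:(lra) ltac:(lra) ltac:(lra)) h.
have -> : (z - y) * phi x + (y - x) * phi z =
  (z - x) * ((1 - t) * phi x + t * phi z) by rewrite /t; field.
by rewrite ler_wpM2l// ltW.
Qed.

(** The ends bound [phi] from above; the point [rho], lying between [x] and [rho + 1],
bounds it from below. *)
Lemma convex_bounded (R : realType) (phi : R -> R) (rho M : R) :
  0 <= rho -> convex_between phi (- rho) (rho + 1) ->
  `|phi (- rho)| <= M -> `|phi rho| <= M -> `|phi (rho + 1)| <= M ->
  forall x, `|x| <= rho -> `|phi x| <= (4 * rho + 1) * M.
Proof.
move=> r0 H; rewrite !ler_norml => /andP[? ?] /andP[? ?] /andP[? ?] x.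
rewrite ler_norml => /andP[x1 x2].
have M0 : 0 <= M by lra.
have rM : 0 <= rho * M by exact: mulr_ge0.
have up : phi x <= M.
  have [r00|rn0] := eqVneq rho 0; first by rewrite (_ : x = rho)//; lra.
  have rp : 0 < 2 * rho by rewrite mulr_gt0// lt0r rn0.
  have c := convex_chord H (lexx _) x1 x2 (ltac:(lra)).
  rewrite -(ler_pM2l rp).
  have : (rho - x) * phi (- rho) <= (rho - x) * M by rewrite ler_wpM2l// subr_ge0.
  have : (x - - rho) * phi rho <= (x - - rho) * M by rewrite ler_wpM2l// subr_ge0.
  lra.
have c := convex_chord H x1 x2 (ltac:(lra) : rho <= rho + 1) (lexx _).
have h1 : (rho + 1 - x) * - M <= (rho + 1 - x) * phi rho by rewrite ler_wpM2l//; lra.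
have h2 : (rho - x) * phi (rho + 1) <= (rho - x) * M by rewrite ler_wpM2l//; lra.
have h3 : - rho * M <= x * M by rewrite ler_wpM2r.
by rewrite ler_norml; apply/andP; split; lra.
Qed.

(** The slope between two points of [-r, r] is bounded by the slopes to [r + 1] and
[-(r + 1)], which are at unit distance at least. *)
Lemma convex_lip (R : realType) (phi : R -> R) (r M : R) :
  convex_between phi (- (r + 1)) (r + 1) ->
  (forall x, `|x| <= r + 1 -> `|phi x| <= M) ->
  forall x y, `|x| <= r -> `|y| <= r -> `|phi x - phi y| <= 2 * M * `|x - y|.
Proof.
move=> H bd.
have key x y : x <= y -> `|x| <= r -> `|y| <= r ->
    `|phi x - phi y| <= 2 * M * `|x - y|.
  move=> xy; rewrite !(ler_norml _ r) => /andP[x1 x2] /andP[y1 y2].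
  have bx : `|phi x| <= M by apply: bd; rewrite ler_norml; apply/andP; split; lra.
  have by' : `|phi y| <= M by apply: bd; rewrite ler_norml; apply/andP; split; lra.
  have b1 : `|phi (- (r + 1))| <= M.
    by apply: bd; rewrite ler_norml; apply/andP; split; lra.
  have b2 : `|phi (r + 1)| <= M by apply: bd; rewrite ler_norml; apply/andP; split; lra.
  move: bx by' b1 b2; rewrite !(ler_norml _ M).
  move=> /andP[? ?] /andP[? ?] /andP[? ?] /andP[? ?].
  have c1 := convex_chord H (ltac:(lra) : - (r + 1) <= - (r + 1))
    (ltac:(lra) : - (r + 1) <= x) xy (ltac:(lra)).
  have c2 := convex_chord H (ltac:(lra) : - (r + 1) <= x) xy
    (ltac:(lra) : y <= r + 1) (ltac:(lra)).
  have yx : 0 <= y - x by rewrite subr_ge0.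
  have M0 : 0 <= (y - x) * M by apply: mulr_ge0 => //; lra.
  have k1 : (r + 1 - x) * (phi y - phi x) <= 2 * M * (y - x).
    have : (y - x) * (phi (r + 1) - phi x) <= (y - x) * (2 * M).
      by rewrite ler_wpM2l//; lra.
    lra.
  have k2 : (y + (r + 1)) * (phi x - phi y) <= 2 * M * (y - x).
    have : (y - x) * (phi (- (r + 1)) - phi y) <= (y - x) * (2 * M).
      by rewrite ler_wpM2l//; lra.
    lra.
  rewrite (distrC (phi x)) (distrC x) (ger0_norm yx) ler_norml; apply/andP; split.
    have [h|h] := leP 0 (phi x - phi y); last lra.
    have : 1 * (phi x - phi y) <= (y + (r + 1)) * (phi x - phi y).
      by rewrite ler_wpM2r//; lra.
    lra.
  have [h|h] := leP 0 (phi y - phi x); last lra.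
  have : 1 * (phi y - phi x) <= (r + 1 - x) * (phi y - phi x).
    by rewrite ler_wpM2r//; lra.
  lra.
move=> x y hx hy; have [xy|yx] := leP x y; first exact: key.
by rewrite (distrC (phi x)) (distrC x); apply: key => //; exact: ltW.
Qed.

Definition in_square (R : realType) (x y : R) := cantor_set 1 x /\ cantor_set 1 y.

(** Local convexity off the square, in coordinates and with boxes as neighbourhoods. *)
Definition convex_off_square (R : realType) (g : R -> R -> R) :=
  forall x y, ~ in_square x y -> exists2 e : R, 0 < e &
    forall x1 y1 x2 y2 l : R, `|x1 - x| < e -> `|y1 - y| < e ->
      `|x2 - x| < e -> `|y2 - y| < e -> 0 <= l <= 1 ->
      g ((1 - l) * x1 + l * x2) ((1 - l) * y1 + l * y2) <=
      (1 - l) * g x1 y1 + l * g x2 y2.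

Lemma convex_off_square_swap (R : realType) (g : R -> R -> R) :
  convex_off_square g -> convex_off_square (fun x y => g y x).
Proof.
move=> H x y xy; have [|e e0 he] := H y x; first by case => ? ?; apply: xy.
by exists e => // *; exact: he.
Qed.

(** The one-variable local-to-global principle, along a segment that misses the square. *)
Lemma convex_on_segment (R : realType) (g : R -> R -> R) (x y u v a b : R) :
  convex_off_square g ->
  (forall t, a <= t <= b -> ~ in_square (x + t * u) (y + t * v)) ->
  convex_between (fun t => g (x + t * u) (y + t * v)) a b.
Proof.
move=> H off; apply: convex_near_between => t /off/H[e e0 he].
pose d := e / (`|u| + `|v| + 1).
have u0 := normr_ge0 u; have v0 := normr_ge0 v.
have p : 0 < `|u| + `|v| + 1 by lra.
have d0 : 0 < d by exact: divr_gt0.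
have small s w : t - d <= s <= t + d -> `|w| <= `|u| + `|v| -> `|(s - t) * w| < e.
  move=> /andP[s1 s2] hw; rewrite normrM.
  have -> : e = d * (`|u| + `|v| + 1) by rewrite /d divfK// gt_eqF.
  have st : `|s - t| <= d by rewrite ler_norml; apply/andP; split; lra.
  apply: (@le_lt_trans _ _ (d * (`|u| + `|v|))); first exact: ler_pM.
  by rewrite ltr_pM2l//; lra.
exists d => // s1 s2 l hs1 hs2 hl.
have -> : x + ((1 - l) * s1 + l * s2) * u = (1 - l) * (x + s1 * u) + l * (x + s2 * u).
  by ring.
have -> : y + ((1 - l) * s1 + l * s2) * v = (1 - l) * (y + s1 * v) + l * (y + s2 * v).
  by ring.
have E s w z : z + s * w - (z + t * w) = (s - t) * w by ring.
by apply: he; rewrite ?E//; apply: small; rewrite // ?lerDl ?lerDr.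
Qed.

Lemma midpoint_off_square (R : realType) (g : R -> R -> R) (x y u v : R) :
  convex_off_square g ->
  (forall t, -1 <= t <= 1 -> ~ in_square (x + t * u) (y + t * v)) ->
  2 * g x y <= g (x - u) (y - v) + g (x + u) (y + v).
Proof.
move=> /convex_on_segment/[apply]/(_ (-1) 1 (1 / 2)).
move=> /(_ ltac:(lra) ltac:(lra) ltac:(lra)).
rewrite (_ : (1 - 1 / 2) * -1 + 1 / 2 * 1 = 0); last by field.
rewrite !mulN1r !mul1r !mul0r !addr0; lra.
Qed.

Lemma not_cantor_set_big (R : realType) (x : R) : 1 <= `|x| -> ~ cantor_set 1 x.
Proof. by move=> x1 /(_ 0%N) /=; lra. Qed.

(** The vertical lines [x = -rho], [x = rho] and [x = rho + 1] miss the square, so [g] is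
convex and bounded on each of them near the box. Hence the restrictions of [g] to the
horizontal lines that miss the square are convex and uniformly bounded. *)
Lemma lip_horizontal (R : realType) (g : R -> R -> R) (r : R) :
  convex_off_square g -> 0 <= r ->
  exists2 L : R, 0 <= L & forall x x' y, ~ cantor_set 1 y ->
    `|x| <= r -> `|x'| <= r -> `|y| <= r -> `|g x y - g x' y| <= L * `|x - x'|.
Proof.
move=> H r0; pose rho := r + 1.
have vert (x : R) : 1 <= `|x| -> exists M, forall y, `|y| <= rho -> `|g x y| <= M.
  move=> x1; pose M := `|g x (- rho)| + `|g x rho| + `|g x (rho + 1)|.
  exists ((4 * rho + 1) * M).
  have n1 := normr_ge0 (g x (- rho)); have n2 := normr_ge0 (g x rho).
  have n3 := normr_ge0 (g x (rho + 1)).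
  apply: (convex_bounded (phi := g x)); rewrite /M /rho; try lra.
  have := @convex_on_segment R g x 0 0 1 (- (r + 1)) (r + 1 + 1) H.
  have -> : (fun t => g (x + t * 0) (0 + t * 1)) = g x.
    by apply/funext => t; rewrite mulr0 addr0 add0r mulr1.
  by apply => t _ []; rewrite mulr0 addr0 => /(not_cantor_set_big x1).
have [|M1 h1] := vert (- rho).
  by rewrite normrN ger0_norm /rho; lra.
have [|M2 h2] := vert rho; first by rewrite ger0_norm /rho; lra.
have [|M3 h3] := vert (rho + 1); first by rewrite ger0_norm /rho; lra.
have z : `|0 : R| <= rho by rewrite normr0 /rho; lra.
have p1 := le_trans (normr_ge0 _) (h1 _ z).
have p2 := le_trans (normr_ge0 _) (h2 _ z).
have p3 := le_trans (normr_ge0 _) (h3 _ z).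
pose M := (4 * rho + 1) * (M1 + M2 + M3).
have M0 : 0 <= M by apply: mulr_ge0; rewrite /rho; lra.
exists (2 * M); first lra.
move=> x x' y Cy xr x'r yr.
have yrho : `|y| <= rho by rewrite /rho; lra.
have cvx a b : convex_between (g^~ y) a b.
  have := @convex_on_segment R g 0 y 1 0 a b H.
  have -> : (fun t => g (0 + t * 1) (y + t * 0)) = g^~ y.
    by apply/funext => t; rewrite mulr0 addr0 add0r mulr1.
  by apply => t _ []; rewrite mulr0 addr0.
apply: (convex_lip (r := r) (phi := g^~ y)) => //.
have r0' : 0 <= rho by rewrite /rho; lra.
apply: (convex_bounded r0' (cvx _ _)).
- by apply: le_trans (h1 y yrho) _; lra.
- by apply: le_trans (h2 y yrho) _; lra.
- by apply: le_trans (h3 y yrho) _; lra.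
Qed.

Lemma off_line_near (R : realType) (x e : R) : 0 < e ->
  exists2 y, `|y - x| < e & ~ cantor_set 1 y.
Proof.
move=> /(cantor_set_dense x)[y yx Cy]; exists y => // C1.
by apply: Cy => n; exact: cantor12.
Qed.

Lemma ler_norm_near (R : realType) (x y r : R) (e : R) :
  `|y - x| <= e -> e <= 1 -> `|x| <= r -> `|y| <= r + 1.
Proof.
rewrite !ler_norml => /andP[? ?] ? /andP[? ?].
by apply/andP; split; lra.
Qed.

Lemma dist_near (R : realType) (a b c d e : R) :
  `|a - b| <= e -> `|c - d| <= e -> `|a - c| <= `|b - d| + 2 * e.
Proof.
move=> ab cd; have -> : a - c = (a - b) + (b - d) + (d - c) by ring.
rewrite (le_trans (ler_normD _ _))// (le_trans (lerD (ler_normD _ _) (lexx _)))//.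
by rewrite (distrC d); lra.
Qed.

(** Two points none of whose coordinates is in the Cantor set are joined by a horizontal
and a vertical segment on lines that miss the square; such points are dense, and each
point off the square is reached from them along a line that misses it. *)
Lemma lip_off_square (R : realType) (g : R -> R -> R) (r : R) :
  convex_off_square g -> 0 <= r ->
  exists2 L : R, 0 <= L & forall x y x' y', ~ in_square x y -> ~ in_square x' y' ->
    `|x| <= r -> `|y| <= r -> `|x'| <= r -> `|y'| <= r ->
    `|g x y - g x' y'| <= L * (`|x - x'| + `|y - y'|).
Proof.
move=> H r0; have r1 : 0 <= r + 1 by lra.
have [L1 L10 h1] := lip_horizontal H r1.
have [L2 L20 h2] := lip_horizontal (convex_off_square_swap H) r1.
pose L := L1 + L2.
have L0 : 0 <= L by rewrite /L; lra.
have {}h1 x x' y : ~ cantor_set 1 y -> `|x| <= r + 1 -> `|x'| <= r + 1 ->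
    `|y| <= r + 1 -> `|g x y - g x' y| <= L * `|x - x'|.
  move=> ? ? ? ?; apply: le_trans (h1 _ _ _ _ _ _ _) _ => //.
  by rewrite ler_wpM2r// /L; lra.
have {}h2 x y y' : ~ cantor_set 1 x -> `|y| <= r + 1 -> `|y'| <= r + 1 ->
    `|x| <= r + 1 -> `|g x y - g x y'| <= L * `|y - y'|.
  move=> ? ? ? ?; apply: le_trans (h2 _ _ _ _ _ _ _) _ => //.
  by rewrite ler_wpM2r// /L; lra.
have approx x y (e : R) : ~ in_square x y -> `|x| <= r -> `|y| <= r -> 0 < e < 1 ->
    exists x1 y1, [/\ ~ cantor_set 1 x1, ~ cantor_set 1 y1, `|x1 - x| <= e,
       `|y1 - y| <= e & `|g x y - g x1 y1| <= L * e].
  move=> sq xr yr /andP[e0 e1].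
  have [Cy|Cy] := pselect (cantor_set 1 y).
    have Cx : ~ cantor_set 1 x by move=> ?; apply: sq.
    have [y1 /ltW yy1 Cy1] := off_line_near y e0.
    exists x, y1; split => //; first by rewrite subrr normr0 ltW.
    apply: le_trans (h2 _ _ _ _ _ _ _) _ => //; try lra.
      exact: (ler_norm_near yy1 (ltW e1) yr).
    by rewrite ler_wpM2l// distrC.
  have [x1 /ltW xx1 Cx1] := off_line_near x e0.
  exists x1, y; split => //; first by rewrite subrr normr0 ltW.
  apply: le_trans (h1 _ _ _ _ _ _ _) _ => //; try lra.
    exact: (ler_norm_near xx1 (ltW e1) xr).
  by rewrite ler_wpM2l// distrC.
exists L => // x y x' y' sq sq' xr yr xr' yr'.
apply: (@ler_of_eps _ _ _ (6 * L)); first lra.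
move=> e e01; have /andP[e0 e1] := e01.
have [x1 [y1 [Cx1 Cy1 dx1 dy1 b1]]] := approx _ _ _ sq xr yr e01.
have [x2 [y2 [Cx2 Cy2 dx2 dy2 b2]]] := approx _ _ _ sq' xr' yr' e01.
have x1r := ler_norm_near dx1 (ltW e1) xr; have y1r := ler_norm_near dy1 (ltW e1) yr.
have x2r := ler_norm_near dx2 (ltW e1) xr'; have y2r := ler_norm_near dy2 (ltW e1) yr'.
have c1 := h1 _ _ _ Cy1 x1r x2r y1r.
have c2 := h2 _ _ _ Cx2 y1r y2r x2r.
have d1 := dist_near dx1 dx2; have d2 := dist_near dy1 dy2.
have e1' : L * `|x1 - x2| <= L * (`|x - x'| + 2 * e) by rewrite ler_wpM2l.
have e2' : L * `|y1 - y2| <= L * (`|y - y'| + 2 * e) by rewrite ler_wpM2l.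
have -> : g x y - g x' y' = (g x y - g x1 y1) + (g x1 y1 - g x2 y1) +
  (g x2 y1 - g x2 y2) - (g x' y' - g x2 y2) by ring.
apply: le_trans (ler_normB _ _) _.
apply: le_trans (lerD (ler_normD _ _) (lexx _)) _.
apply: le_trans (lerD (lerD (ler_normD _ _) (lexx _)) (lexx _)) _.
lra.
Qed.

(** * Continuous extension to the square *)

Definition lip_on_boxes (R : realType) (F : R -> R -> R) :=
  forall r : R, 0 <= r -> exists2 L : R, 0 <= L & forall x y x' y',
    `|x| <= r -> `|y| <= r -> `|x'| <= r -> `|y'| <= r ->
    `|F x y - F x' y'| <= L * (`|x - x'| + `|y - y'|).

Definition second_diff (R : realType) (F : R -> R -> R) (u v x y : R) :=
  F (x + u) (y + v) + F (x - u) (y - v) - 2 * F x y.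

(** The McShane extension [sup (g q - L1 |p - q|)] gives the values on the square from
the Lipschitz bound on one box; approximation by points off the square then carries the
bounds of all boxes over to the extension. *)
Lemma extend_to_square (R : realType) (g : R -> R -> R) : convex_off_square g ->
  exists2 F, lip_on_boxes F & forall x y, ~ in_square x y -> F x y = g x y.
Proof.
move=> H; have [L1 L10 lip1] := lip_off_square H (ltac:(lra) : 0 <= 2 :> R).
have Cle1 (x : R) : cantor_set 1 x -> `|x| <= 1 by move=> /(_ 0%N)/=; lra.
have ext (p : R * R) : exists v, (~ in_square p.1 p.2 -> v = g p.1 p.2) /\
    (in_square p.1 p.2 -> forall x y, ~ in_square x y -> `|x| <= 2 -> `|y| <= 2 ->
       `|v - g x y| <= L1 * (`|p.1 - x| + `|p.2 - y|)).
  case: p => px py /=.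
  have [[Cx Cy]|nsq] := pselect (in_square px py); last by exists (g px py); split.
  pose A : set R := [set z | exists x y,
    [/\ ~ in_square x y, `|x| <= 2, `|y| <= 2 & z = g x y - L1 * (`|px - x| + `|py - y|)]].
  have A0 : A !=set0.
    exists (g 1 1 - L1 * (`|px - 1| + `|py - 1|)), 1, 1.
    rewrite normr1; split=> //; try lra.
    by case=> C1 _; apply: (@not_cantor_set_big R 1) C1; rewrite normr1.
  have ubA x y : ~ in_square x y -> `|x| <= 2 -> `|y| <= 2 ->
      ubound A (g x y + L1 * (`|px - x| + `|py - y|)).
    move=> sq x2 y2 _ [x' [y' [sq' x2' y2' ->]]].
    have := lip1 _ _ _ _ sq' sq x2' y2' x2 y2.
    have t1 : `|x' - x| <= `|px - x'| + `|px - x|.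
      by rewrite (distrC px x'); exact: ler_distD.
    have t2 : `|y' - y| <= `|py - y'| + `|py - y|.
      by rewrite (distrC py y'); exact: ler_distD.
    have : L1 * (`|x' - x| + `|y' - y|) <=
        L1 * (`|px - x'| + `|px - x| + (`|py - y'| + `|py - y|)).
      by rewrite ler_wpM2l// lerD.
    move=> h1; rewrite ler_norml => /andP[_ h2]; lra.
  exists (sup A); split => [|_ x y sq x2 y2]; first by move=> []; split.
  rewrite ler_norml; apply/andP; split.
    have := ub_le_sup (ex_intro _ _ (ubA _ _ sq x2 y2)).
    move=> /(_ (g x y - L1 * (`|px - x| + `|py - y|)) (ex_intro _ x (ex_intro _ y _))).
    by move=> /(_ (And4 sq x2 y2 erefl)); lra.
  by have := ge_sup A0 (ubA _ _ sq x2 y2); lra.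
have [f fP] := choice ext; pose F x y := f (x, y).
exists F; last by move=> x y; exact: (fP (x, y)).1.
move=> r r0; have [L L0 lip] := lip_off_square H (ltac:(lra) : 0 <= r + 1).
have approx x y (e : R) : 0 < e < 1 -> `|x| <= r -> `|y| <= r ->
    exists x1 y1, [/\ ~ in_square x1 y1, `|x1 - x| <= e, `|y1 - y| <= e &
      `|F x y - g x1 y1| <= L1 * e].
  move=> /andP[e0 e1] xr yr.
  have [sq|nsq] := pselect (in_square x y); last first.
    exists x, y; split => //; [by rewrite subrr normr0 ltW|by rewrite subrr normr0 ltW|].
    by rewrite /F (fP (x, y)).1//= subrr normr0 mulr_ge0// ltW.
  have [x1 /ltW dx1 Cx1] := off_line_near x e0.
  exists x1, y; split => //; [by case|by rewrite subrr normr0 ltW|].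
  have := (fP (x, y)).2 sq x1 y; rewrite subrr normr0 addr0 => h.
  apply: le_trans (h _ _ _) _.
  - by case.
  - have := ler_norm_near dx1 (ltW e1) (Cle1 _ sq.1); lra.
  - by have := Cle1 _ sq.2; lra.
  - by rewrite ler_wpM2l// distrC.
exists L => // x y x' y' xr yr xr' yr'.
apply: (@ler_of_eps _ _ _ (4 * L + 2 * L1)); first lra.
move=> e e01; have /andP[e0 e1] := e01.
have [x1 [y1 [sq1 dx1 dy1 b1]]] := approx _ _ _ e01 xr yr.
have [x2 [y2 [sq2 dx2 dy2 b2]]] := approx _ _ _ e01 xr' yr'.
have x1r := ler_norm_near dx1 (ltW e1) xr; have y1r := ler_norm_near dy1 (ltW e1) yr.
have x2r := ler_norm_near dx2 (ltW e1) xr'; have y2r := ler_norm_near dy2 (ltW e1) yr'.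
have c := lip _ _ _ _ sq1 sq2 x1r y1r x2r y2r.
have d1 := dist_near dx1 dx2; have d2 := dist_near dy1 dy2.
have e1' : L * (`|x1 - x2| + `|y1 - y2|) <= L * (`|x - x'| + 2 * e + (`|y - y'| + 2 * e)).
  by rewrite ler_wpM2l// lerD.
have -> : F x y - F x' y' = (F x y - g x1 y1) + (g x1 y1 - g x2 y2) -
  (F x' y' - g x2 y2) by ring.
apply: le_trans (ler_normB _ _) _.
apply: le_trans (lerD (ler_normD _ _) (lexx _)) _.
lra.
Qed.

(** By continuity it is enough to have approximate nonnegativity at nearby points and for
nearby steps. *)
Lemma second_diff_limit (R : realType) (F : R -> R -> R) (u v x y : R) :
  lip_on_boxes F ->
  (forall e : R, 0 < e < 1 -> exists u' v' x' y',
     [/\ `|u' - u| <= e, `|v' - v| <= e, `|x' - x| <= e & `|y' - y| <= e] /\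
     - e <= second_diff F u' v' x' y') ->
  0 <= second_diff F u v x y.
Proof.
move=> lipF H.
have nx := normr_ge0 x; have ny := normr_ge0 y.
have nu := normr_ge0 u; have nv := normr_ge0 v.
pose r := `|x| + `|y| + `|u| + `|v|.
have [|L L0 lip] := lipF (r + 2); first by rewrite /r; lra.
apply: (@ler_of_eps _ _ _ (16 * L + 1)); first lra.
move=> e e01; have [u' [v' [x' [y' [[du dv dx dy]]]]]] := H e e01.
have /andP[e0 e1] := e01.
move: du dv dx dy; rewrite /second_diff !(ler_norml _ e).
move=> /andP[? ?] /andP[? ?] /andP[? ?] /andP[? ?].
have nnx := ler_norm x; have nnx' := ler_norm (- x).
have nny := ler_norm y; have nny' := ler_norm (- y).
have nnu := ler_norm u; have nnu' := ler_norm (- u).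
have nnv := ler_norm v; have nnv' := ler_norm (- v).
rewrite !normrN in nnx' nny' nnu' nnv'.
have bd a b a' b' : - (r + 2) <= a <= r + 2 -> - (r + 2) <= b <= r + 2 ->
    - (r + 2) <= a' <= r + 2 -> - (r + 2) <= b' <= r + 2 ->
    - (2 * e) <= a' - a <= 2 * e -> - (2 * e) <= b' - b <= 2 * e ->
    F a b - F a' b' <= 4 * L * e /\ F a' b' - F a b <= 4 * L * e.
  rewrite -!ler_norml => ar br ar' br' da db.
  have := lip _ _ _ _ ar br ar' br'.
  have : L * (`|a - a'| + `|b - b'|) <= L * (2 * e + 2 * e).
    by rewrite ler_wpM2l// (distrC a) (distrC b) lerD.
  move=> h1; rewrite ler_norml => /andP[h2 h3]; split; lra.
rewrite /r in bd.
have [_ k1] := bd (x + u) (y + v) (x' + u') (y' + v') (ltac:(lra)) (ltac:(lra))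
  (ltac:(lra)) (ltac:(lra)) (ltac:(lra)) (ltac:(lra)).
have [_ k2] := bd (x - u) (y - v) (x' - u') (y' - v') (ltac:(lra)) (ltac:(lra))
  (ltac:(lra)) (ltac:(lra)) (ltac:(lra)) (ltac:(lra)).
have [k3 _] := bd x y x' y' (ltac:(lra)) (ltac:(lra))
  (ltac:(lra)) (ltac:(lra)) (ltac:(lra)) (ltac:(lra)).
by move=> h; lra.
Qed.

(** * Second differences along diagonals that come near the square *)

Lemma count_below (R : realType) (S : nat) (b : R) : 0 <= b + 1 ->
  \sum_(k < S) ((k%:R <= b)%R)%:R <= b + 1.
Proof.
elim: S b => [|S IH] b b1; first by rewrite big_ord0.
rewrite big_ord_recl /=.
have -> : \sum_(i < S) (((bump 0 i)%:R <= b)%R)%:R = \sum_(k < S) ((k%:R <= b - 1)%R)%:R :> R.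
  by apply: eq_bigr => i _; rewrite /bump/= natrD lerBrDl.
have [b0|b0] := leP 0 b.
  by have := IH (b - 1) (ltac:(lra)); rewrite mulr1n; lra.
rewrite big1 ?addr0// => i _.
by rewrite leNgt (lt_le_trans (_ : b - 1 < 0))//; lra.
Qed.

Lemma count_interval (R : realType) (S : nat) (a l : R) : 0 <= l ->
  \sum_(k < S) ((a <= k%:R <= a + l)%R)%:R <= l + 1.
Proof.
move=> l0; elim: S a => [|S IH] a; first by rewrite big_ord0; lra.
have [a0|a0] := leP a 0.
  have [al|al] := leP 0 (a + l + 1); last first.
    rewrite big1 ?addr_ge0// => i _; case: andP => // -[_ h].
    have := ler0n R i; lra.
  apply: (@le_trans _ _ (\sum_(k < S.+1) ((k%:R <= a + l)%R)%:R)).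
    by apply: ler_sum => i _; rewrite ler_nat; case: (a <= _) => //; case: (_ <= a + l).
  by apply: le_trans (count_below _ al) _; lra.
have na : (a <= 0%:R) = false by rewrite leNgt a0.
rewrite big_ord_recl /= na /= add0r.
apply: le_trans (IH (a - 1)); apply: ler_sum => i _; rewrite ler_nat /bump/= natrD.
by rewrite lerBlDl (_ : a - 1 + l = (a + l) - 1) ?lerBrDl//; ring.
Qed.

(** The lattice points near the scaled Cantor set of sums: each level splits them into
five translated copies of the preceding level. *)
Lemma count_cantor (R : realType) (S n : nat) (xi rho : R) : 0 <= rho ->
  \sum_(k < S) (`[< exists2 z, cantor 2 n z & `|6 ^+ n * z - (xi + k%:R)| <= rho >])%:R
    <= 5 ^+ n * (2 * rho + 2).
Proof.
move=> rho0; elim: n xi => [|n IH] xi.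
  rewrite expr0 mul1r.
  have h := @count_interval R S (- xi - (2 / 5 + rho)) (2 * (2 / 5 + rho)) (ltac:(lra)).
  apply: (@le_trans _ _ (2 * (2 / 5 + rho) + 1)); last lra.
  apply: le_trans h; apply: ler_sum => k _; rewrite ler_nat.
  case: asboolP => // -[z /=]; rewrite !ler_norml => /andP[? ?] /andP[? ?].
  by rewrite (_ : _ && _)//; apply/andP; split; lra.
pose A (d : 'I_5) k := `[< exists2 z, cantor 2 n z &
   `|6 ^+ n * z - (xi - 6 ^+ n * (d%:R - 2) + k%:R)| <= rho >].
apply: (@le_trans _ _ (\sum_(k < S) \sum_(d < 5) (A d k)%:R)).
  apply: ler_sum => k _; case: asboolP => [[z /= [d hz] hk]|_]; last exact: sumr_ge0.
  have Ad : A d k = true.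
    apply/asboolP; exists (6 * z - (d%:R - 2)) => //.
    by move: hk; congr (`|_| <= _); rewrite exprS; ring.
  rewrite (bigD1 d)//= Ad.
  by rewrite lerDl sumr_ge0.
rewrite exchange_big/=.
apply: (@le_trans _ _ (\sum_(d < 5) 5 ^+ n * (2 * rho + 2))).
  by apply: ler_sum => d _; exact: IH.
by rewrite sumr_const card_ord -mulrnAl exprSr mulr_natr.
Qed.

Lemma second_diffN (R : realType) (F : R -> R -> R) (u v x y : R) :
  second_diff F (- u) (- v) x y = second_diff F u v x y.
Proof. by rewrite /second_diff !opprK; ring. Qed.

(** Being within [rho] of the sums and differences of points of the Cantor set: the lines
[x + y = z] and [x - y = z] that come near the square satisfy it. *)
Definition near_sums (R : realType) (rho z : R) : bool :=
  `[< exists2 t, cantor_set 2 t & `|t - z| <= rho >].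

(** On each diagonal [i + j = k] the nonnegative second differences telescope to a
difference of two increments of [F], which is at most [4 h L]; the sum is then over the
diagonals [k < 2 N] near the square. *)
Lemma diagonal_sum (R : realType) (F : R -> R -> R) (h L r X Y Z rho : R) (N : nat) :
  0 <= h -> 0 <= L ->
  (forall x y x' y', `|x| <= r -> `|y| <= r -> `|x'| <= r -> `|y'| <= r ->
    `|F x y - F x' y'| <= L * (`|x - x'| + `|y - y'|)) ->
  (forall x y, 0 <= second_diff F h (- h) x y) ->
  `|X| + `|Y| + (3 * N%:R + 2) * h <= r ->
  \sum_(i < N) \sum_(j < N)
     (near_sums rho (Z + (i + j)%:R * h))%:R *
     second_diff F h (- h) (X + i%:R * h) (Y + j%:R * h)
  <= (\sum_(k < 2 * N) (near_sums rho (Z + k%:R * h))%:R) * (4 * h * L).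
Proof.
move=> h0 L0 lip pos hr.
pose T (i k : nat) := second_diff F h (- h) (X + i%:R * h) (Y + (k%:R - i%:R) * h).
pose nu (k : nat) : R := (near_sums rho (Z + k%:R * h))%:R.
have nu0 k : 0 <= nu k by exact: ler0n.
have row (i : 'I_N) : \sum_(j < N) nu (i + j)%N * T i (i + j)%N <=
    \sum_(k < 2 * N) nu k * T i k.
  have le1 : (i <= N + i)%N by rewrite leq_addl.
  have le2 : (N + i <= 2 * N)%N by rewrite mul2n -addnn leq_add2l ltnW.
  rewrite -(big_mkord xpredT (fun k => nu k * T i k)).
  rewrite (big_cat_nat (leq0n i) (leq_trans le1 le2))/=.
  rewrite (big_cat_nat le1 le2)/=.
  have -> : \sum_(i <= k < N + i) nu k * T i k =
      \sum_(j < N) nu (i + j)%N * T i (i + j)%N.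
    rewrite -{1}(add0n i) big_addn addnK big_mkord.
    by apply: eq_bigr => j _; rewrite addnC.
  have p a b : 0 <= \sum_(a <= k < b) nu k * T i k.
    by apply: sumr_ge0 => k _; rewrite mulr_ge0// /T.
  by rewrite addrCA lerDl addr_ge0.
apply: (@le_trans _ _ (\sum_(i < N) \sum_(k < 2 * N) nu k * T i k)).
  apply: ler_sum => i _; apply: le_trans (row i); apply: ler_sum => j _.
  rewrite /nu /T natrD.
  by rewrite (_ : i%:R + j%:R - i%:R = j%:R :> R)//; ring.
rewrite exchange_big/= mulr_suml; apply: ler_sum => k _.
rewrite -mulr_sumr; apply: ler_wpM2l => //.
(* [phi] samples [F] on the diagonal [k], starting one step before the window. *)
pose phi (i : nat) := F (X + i%:R * h - h) (Y + (k%:R - i%:R) * h + h).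
have -> : \sum_(i < N) T i k = (phi N.+1 - phi N) - (phi 1%N - phi 0%N).
  have -> : \sum_(i < N) T i k = \sum_(0 <= i < N)
      ((phi i.+2 - phi i.+1) - (phi i.+1 - phi i)).
    rewrite big_mkord; apply: eq_bigr => i _.
    rewrite /T /second_diff /phi -(natr1 i.+1) -(natr1 i).
    have -> : X + (i%:R + 1 + 1) * h - h = X + i%:R * h + h by ring.
    have -> : Y + (k%:R - (i%:R + 1 + 1)) * h + h = Y + (k%:R - i%:R) * h - h by ring.
    have -> : X + (i%:R + 1) * h - h = X + i%:R * h by ring.
    have -> : Y + (k%:R - (i%:R + 1)) * h + h = Y + (k%:R - i%:R) * h by ring.
    by rewrite opprK; ring.
  by rewrite (telescope_sumr (fun i => phi i.+1 - phi i)).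
have kN : k%:R <= 2 * N%:R :> R by rewrite -natrM ler_nat ltnW.
have kh : k%:R * h <= 2 * N%:R * h by rewrite ler_wpM2r.
have kh0 : 0 <= k%:R * h by rewrite mulr_ge0.
have Nh0 : 0 <= N%:R * h by rewrite mulr_ge0.
have nx := normr_ge0 X; have ny := normr_ge0 Y.
have nnx := ler_norm X; have nnx' := ler_norm (- X).
have nny := ler_norm Y; have nny' := ler_norm (- Y).
rewrite !normrN in nnx' nny'.
have step (i : nat) : (i <= N)%N -> `|phi i.+1 - phi i| <= 2 * h * L.
  move=> iN; have iN' : i%:R * h <= N%:R * h by rewrite ler_wpM2r// ler_nat.
  have ih0 : 0 <= i%:R * h by rewrite mulr_ge0.
  rewrite /phi; apply: le_trans (lip _ _ _ _ _ _ _ _) _; rewrite -?(natr1 i);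
    try by rewrite ler_norml; apply/andP; split; lra.
  have -> : X + (i%:R + 1) * h - h - (X + i%:R * h - h) = h by ring.
  have -> : Y + (k%:R - (i%:R + 1)) * h + h - (Y + (k%:R - i%:R) * h + h) = - h.
    by ring.
  by rewrite normrN ger0_norm//; lra.
have := step N (leqnn _); have := step 0%N (leq0n _).
rewrite !ler_norml => /andP[? ?] /andP[? ?]; lra.
Qed.

(** * Second differences in lattice directions *)

(** The mixed difference over a rectangle of sides [2 p h] and [2 q h] is the sum of those
over squares of side [2 h], and over a square it is the difference of the second
differences along the two diagonals. This is the discrete polarisation identity. *)
Lemma rectangle_split (R : realType) (F : R -> R -> R) (h x y : R) (p q : nat) :
  \sum_(i < p) \sum_(j < q)
    (second_diff F h h (x + (2 * i%:R + 1 - p%:R) * h) (y + (2 * j%:R + 1 - q%:R) * h) -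
     second_diff F h (- h) (x + (2 * i%:R + 1 - p%:R) * h) (y + (2 * j%:R + 1 - q%:R) * h)) =
  second_diff F (p%:R * h) (q%:R * h) x y - second_diff F (p%:R * h) (- (q%:R * h)) x y.
Proof.
pose G (i j : nat) := F (x + (2 * i%:R - p%:R) * h) (y + (2 * j%:R - q%:R) * h).
transitivity (\sum_(0 <= i < p) ((G i.+1 q - G i.+1 0%N) - (G i q - G i 0%N))).
  rewrite big_mkord; apply: eq_bigr => i _.
  transitivity (\sum_(0 <= j < q) ((G i.+1 j.+1 - G i j.+1) - (G i.+1 j - G i j))).
    rewrite big_mkord; apply: eq_bigr => j _.
    rewrite /second_diff /G -(natr1 i) -(natr1 j).
    have -> : x + (2 * (i%:R + 1) - p%:R) * h = x + (2 * i%:R + 1 - p%:R) * h + h by ring.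
    have -> : x + (2 * i%:R - p%:R) * h = x + (2 * i%:R + 1 - p%:R) * h - h by ring.
    have -> : y + (2 * (j%:R + 1) - q%:R) * h = y + (2 * j%:R + 1 - q%:R) * h + h by ring.
    have -> : y + (2 * j%:R - q%:R) * h = y + (2 * j%:R + 1 - q%:R) * h - h by ring.
    by rewrite opprK; ring.
  rewrite (telescope_sumr (fun j => G i.+1 j - G i j))//; ring.
rewrite (telescope_sumr (fun i => G i q - G i 0%N))// /second_diff /G.
have -> : x + (2 * p%:R - p%:R) * h = x + p%:R * h by ring.
have -> : x + (2 * 0%:R - p%:R) * h = x - p%:R * h by ring.
have -> : y + (2 * q%:R - q%:R) * h = y + q%:R * h by ring.
have -> : y + (2 * 0%:R - q%:R) * h = y - q%:R * h by ring.
by rewrite opprK; ring.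
Qed.

(** Midpoint convexity in the directions (1, 0), (0, 1), (1, 1) and (1, -1). *)
Definition axes_convex (R : realType) (F : R -> R -> R) :=
  forall s x y, [/\ 0 <= second_diff F s 0 x y, 0 <= second_diff F 0 s x y,
    0 <= second_diff F s s x y & 0 <= second_diff F s (- s) x y].

(** The second differences along [(u, v)] and [(u, -v)] have a nonnegative sum, by convexity
along the axes, and their difference is the mixed difference over a rectangle. *)
Lemma second_diff_ge_diagonals (R : realType) (F : R -> R -> R) (h x y sg : R) (p q : nat) :
  axes_convex F -> sg = 1 \/ sg = -1 ->
  - \sum_(i < p) \sum_(j < q)
    (second_diff F h h (x + (2 * i%:R + 1 - p%:R) * h) (y + (2 * j%:R + 1 - q%:R) * h) +
     second_diff F h (- h) (x + (2 * i%:R + 1 - p%:R) * h) (y + (2 * j%:R + 1 - q%:R) * h))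
  <= 2 * second_diff F (p%:R * h) (sg * (q%:R * h)) x y.
Proof.
move=> conv sgE; set u := p%:R * h; set v := q%:R * h.
(* Convexity on the two vertical sides of the rectangle and on its middle line. *)
have par : 0 <= second_diff F u v x y + second_diff F u (- v) x y.
  have [_ h1 _ _] := conv v (x + u) y; have [_ h2 _ _] := conv v (x - u) y.
  have [h3 _ _ _] := conv u x y.
  have -> : second_diff F u v x y + second_diff F u (- v) x y =
      second_diff F 0 v (x + u) y + second_diff F 0 v (x - u) y +
      2 * second_diff F u 0 x y.
    by rewrite /second_diff !addr0 !subr0 opprK; ring.
  lra.
have rect := rectangle_split F h x y p q; rewrite -/u -/v in rect.
set A := \sum_(i < p) _ in rect.
set S := \sum_(i < p) _.
have : A <= S.
  apply: ler_sum => i _; apply: ler_sum => j _; rewrite lerD2l.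
  have [_ _ _] := conv h (x + (2 * i%:R + 1 - p%:R) * h) (y + (2 * j%:R + 1 - q%:R) * h).
  lra.
have : - A <= S.
  rewrite -sumrN; apply: ler_sum => i _; rewrite -sumrN; apply: ler_sum => j _.
  rewrite opprB addrC lerD2r.
  have [_ _ + _] := conv h (x + (2 * i%:R + 1 - p%:R) * h) (y + (2 * j%:R + 1 - q%:R) * h).
  lra.
by case: sgE => ->; rewrite ?mul1r ?mulN1r; lra.
Qed.

Lemma near_sums_count (R : realType) (S n : nat) (Z c : R) : 0 <= c ->
  \sum_(k < S) (near_sums (c * (6 ^+ n)^-1) (Z + k%:R * (6 ^+ n)^-1))%:R
    <= 5 ^+ n * (2 * c + 2).
Proof.
move=> c0; apply: le_trans (count_cantor S n (6 ^+ n * Z) c0).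
have p0 : 0 < 6 ^+ n :> R by rewrite exprn_gt0.
have pn0 : 6 ^+ n != 0 :> R by rewrite gt_eqF.
apply: ler_sum => k _; rewrite ler_nat.
have [/asboolP[t Ct ht]|//] := boolP (near_sums _ _).
suff /asboolP -> : exists2 z, cantor 2 n z & `|6 ^+ n * z - (6 ^+ n * Z + k%:R)| <= c.
  by [].
exists t => //.
have -> : 6 ^+ n * t - (6 ^+ n * Z + k%:R) = 6 ^+ n * (t - (Z + k%:R * (6 ^+ n)^-1)).
  by field.
by rewrite normrM (gtr0_norm p0) mulrC -ler_pdivlMr.
Qed.

Definition convex_missing_square (R : realType) (F : R -> R -> R) :=
  forall u v x y, (forall t, -1 <= t <= 1 -> ~ in_square (x + t * u) (y + t * v)) ->
    0 <= second_diff F u v x y.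

(** If the segment of the second difference on the right meets the square, then both
diagonals through its centre come near the square; otherwise the second difference is
nonnegative, and so are all the terms on the left. *)
Lemma second_diff_ge_near (R : realType) (F : R -> R -> R) (h x y sg rho : R) (p q : nat) :
  axes_convex F -> convex_missing_square F -> 0 <= h -> sg = 1 \/ sg = -1 ->
  rho = (p + q)%:R * h ->
  - \sum_(i < p) \sum_(j < q)
    ((near_sums rho (x - y))%:R *
      second_diff F h h (x + (2 * i%:R + 1 - p%:R) * h) (y + (2 * j%:R + 1 - q%:R) * h) +
     (near_sums rho (x + y))%:R *
      second_diff F h (- h) (x + (2 * i%:R + 1 - p%:R) * h) (y + (2 * j%:R + 1 - q%:R) * h))
  <= 2 * second_diff F (p%:R * h) (sg * (q%:R * h)) x y.
Proof.
move=> conv miss h0 sgE rhoE.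
case E : (near_sums rho (x - y) && near_sums rho (x + y)).
  move/andP: E => [-> ->].
  under eq_bigr do under eq_bigr do rewrite !mul1r.
  exact: second_diff_ge_diagonals.
have D2 : 0 <= second_diff F (p%:R * h) (sg * (q%:R * h)) x y.
  apply: miss => t /andP[t1 t2] [Cx Cy].
  have ph0 : 0 <= p%:R * h by rewrite mulr_ge0.
  have qh0 : 0 <= q%:R * h by rewrite mulr_ge0.
  have tp : `|t * (p%:R * h)| <= p%:R * h.
    by rewrite normrM (ger0_norm ph0) ler_piMl// ler_norml t1.
  have tq : `|t * (sg * (q%:R * h))| <= q%:R * h.
    rewrite !normrM (_ : `|sg| = 1) ?mul1r.
      rewrite -normrM (ger0_norm qh0) ler_piMl// ler_norml t1//.
    by case: sgE => ->; rewrite ?normrN normr1.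
  move/negP: E; apply; apply/andP; split; apply/asboolP.
  - exists (x + t * (p%:R * h) - (y + t * (sg * (q%:R * h)))).
      by move=> n; apply: cantorD (Cx n) (cantorN (Cy n)).
    rewrite (_ : _ - (x - y) = t * (p%:R * h) - t * (sg * (q%:R * h))); last by ring.
    by rewrite rhoE natrD mulrDl; apply: le_trans (ler_normB _ _) _; exact: lerD.
  - exists (x + t * (p%:R * h) + (y + t * (sg * (q%:R * h)))).
      by move=> n; apply: cantorD (Cx n) (Cy n).
    rewrite (_ : _ - (x + y) = t * (p%:R * h) + t * (sg * (q%:R * h))); last by ring.
    by rewrite rhoE natrD mulrDl; apply: le_trans (ler_normD _ _) _; exact: lerD.
apply: (@le_trans _ _ 0); last by rewrite mulr_ge0.
rewrite oppr_le0; apply: sumr_ge0 => i _; apply: sumr_ge0 => j _.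
have [_ _ h1 h2] := conv h (x + (2 * i%:R + 1 - p%:R) * h) (y + (2 * j%:R + 1 - q%:R) * h).
by rewrite addr_ge0// mulr_ge0.
Qed.

Lemma lip_reflect (R : realType) (F : R -> R -> R) (r L : R) :
  (forall x y x' y', `|x| <= r -> `|y| <= r -> `|x'| <= r -> `|y'| <= r ->
    `|F x y - F x' y'| <= L * (`|x - x'| + `|y - y'|)) ->
  (forall x y x' y', `|x| <= r -> `|y| <= r -> `|x'| <= r -> `|y'| <= r ->
    `|F x (- y) - F x' (- y')| <= L * (`|x - x'| + `|y - y'|)).
Proof.
move=> lip x y x' y' xr yr x'r y'r.
apply: le_trans (lip _ _ _ _ _ _ _ _) _; rewrite ?normrN//.
by rewrite -opprD normrN.
Qed.

(** The defect of convexity summed over an [N x N] window. After exchanging sums, each of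
the [p q] shifts contributes two diagonal sums; the one along (1, 1) becomes one along
(1, -1) for the reflected function [F x (- y)], with the second index reversed. *)
Lemma window_sum (R : realType) (F : R -> R -> R) (n N p q : nat) (h L r X Y sg : R) :
  axes_convex F -> convex_missing_square F -> sg = 1 \/ sg = -1 ->
  h = (6 ^+ n)^-1 -> 0 <= L ->
  (forall x y x' y', `|x| <= r -> `|y| <= r -> `|x'| <= r -> `|y'| <= r ->
    `|F x y - F x' y'| <= L * (`|x - x'| + `|y - y'|)) ->
  `|X| + `|Y| + (4 * N%:R + p%:R + q%:R + 3) * h <= r ->
  - ((p * q)%:R * (5 ^+ n * (2 * (p + q)%:R + 2) * (4 * h * L))) <=
  \sum_(i < N) \sum_(j < N)
     second_diff F (p%:R * h) (sg * (q%:R * h)) (X + i%:R * h) (Y + j%:R * h).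
Proof.
move=> conv miss sgE hE L0 lip box.
have h0 : 0 <= h by rewrite hE invr_ge0 exprn_ge0.
pose rho := (p + q)%:R * h.
pose xi (a : 'I_p) : R := (2 * a%:R + 1 - p%:R) * h.
pose et (b : 'I_q) : R := (2 * b%:R + 1 - q%:R) * h.
set B := 5 ^+ n * _ * _.
pose P a b := \sum_(i < N) \sum_(j < N)
  (near_sums rho (X + i%:R * h - (Y + j%:R * h)))%:R *
  second_diff F h h (X + i%:R * h + xi a) (Y + j%:R * h + et b).
pose Q a b := \sum_(i < N) \sum_(j < N)
  (near_sums rho (X + i%:R * h + (Y + j%:R * h)))%:R *
  second_diff F h (- h) (X + i%:R * h + xi a) (Y + j%:R * h + et b).
have coord (k : nat) (c : 'I_k) : `|(2 * c%:R + 1 - k%:R) * h| <= k%:R * h.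
  rewrite normrM (ger0_norm h0) ler_wpM2r//.
  have ck : c%:R + 1 <= k%:R :> R by rewrite natr1 ler_nat.
  have c0 : 0 <= c%:R :> R by [].
  by rewrite ler_norml; apply/andP; split; lra.
have cnt Z : (\sum_(k < 2 * N) (near_sums rho (Z + k%:R * h))%:R) * (4 * h * L) <= B.
  by rewrite ler_wpM2r ?mulr_ge0// /rho hE near_sums_count.
have boxab (a : 'I_p) (b : 'I_q) :
    `|X + xi a| + (`|Y + et b| + (N%:R + 1) * h) + (3 * N%:R + 2) * h <= r.
  have t1 : `|X + xi a| <= `|X| + p%:R * h.
    by apply: le_trans (ler_normD _ _) _; rewrite lerD2l; exact: coord.
  have t2 : `|Y + et b| <= `|Y| + q%:R * h.
    by apply: le_trans (ler_normD _ _) _; rewrite lerD2l; exact: coord.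
  lra.
have Nh0 : 0 <= (N%:R + 1) * h by rewrite mulr_ge0// addr_ge0.
have Qle a b : Q a b <= B.
  apply: le_trans (cnt (X + Y)).
  apply: le_trans (diagonal_sum (r := r) (X := X + xi a) (Y := Y + et b) _ _ h0 L0 lip _ _).
  - apply: ler_sum => i _; apply: ler_sum => j _.
    rewrite (_ : X + i%:R * h + (Y + j%:R * h) = X + Y + (i + j)%:R * h).
      rewrite (_ : X + i%:R * h + xi a = X + xi a + i%:R * h); last by ring.
      by rewrite (_ : Y + j%:R * h + et b = Y + et b + j%:R * h)//; ring.
    by rewrite natrD; ring.
  - by move=> x y; have [] := conv h x y.
  - by have := boxab a b; lra.
have Ple a b : P a b <= B.
  apply: le_trans (cnt (X - Y - (N%:R - 1) * h)).
  pose F' x y := F x (- y).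
  apply: le_trans (diagonal_sum (r := r) (F := F') (X := X + xi a)
    (Y := - (Y + et b) - (N%:R - 1) * h) _ _ h0 L0 (lip_reflect lip) _ _).
  - apply: ler_sum => i _; rewrite (reindex_inj rev_ord_inj)/=.
    apply: ler_sum => j _.
    have jE : (N - j.+1)%:R = N%:R - (j%:R + 1) :> R by rewrite natrB// natr1.
    rewrite jE (_ : X + i%:R * h - _ = X - Y - (N%:R - 1) * h + (i + j)%:R * h).
      rewrite (_ : second_diff F _ _ _ _ = second_diff F' h (- h) (X + xi a + i%:R * h)
        (- (Y + et b) - (N%:R - 1) * h + j%:R * h))//.
      rewrite /second_diff /F' (_ : X + i%:R * h + xi a = X + xi a + i%:R * h); last by ring.
      rewrite (_ : Y + _ + et b = - (- (Y + et b) - (N%:R - 1) * h + j%:R * h)); last by ring.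
      by rewrite !opprD !opprK.
    by rewrite natrD; ring.
  - move=> x y; have [_ _ + _] := conv h x (- y).
    by rewrite /second_diff /F' !opprD !opprK.
  - have -> : - (Y + et b) - (N%:R - 1) * h = - ((Y + et b) + (N%:R - 1) * h) by ring.
    rewrite normrN; apply: le_trans (boxab a b).
    rewrite lerD2r lerD2l; apply: le_trans (ler_normD _ _) _; rewrite lerD2l.
    rewrite normrM (ger0_norm h0) ler_wpM2r// ler_norml.
    have : 0 <= N%:R :> R by [].
    by move=> ?; apply/andP; split; lra.
have low : - \sum_(a < p) \sum_(b < q) (P a b + Q a b) <=
   2 * \sum_(i < N) \sum_(j < N)
     second_diff F (p%:R * h) (sg * (q%:R * h)) (X + i%:R * h) (Y + j%:R * h).
  have -> : \sum_(a < p) \sum_(b < q) (P a b + Q a b) = \sum_(i < N) \sum_(j < N)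
     \sum_(a < p) \sum_(b < q)
      ((near_sums rho (X + i%:R * h - (Y + j%:R * h)))%:R *
        second_diff F h h (X + i%:R * h + xi a) (Y + j%:R * h + et b) +
      (near_sums rho (X + i%:R * h + (Y + j%:R * h)))%:R *
        second_diff F h (- h) (X + i%:R * h + xi a) (Y + j%:R * h + et b)).
    under eq_bigr do under eq_bigr do rewrite /P /Q -big_split/=.
    under eq_bigr do under eq_bigr do under eq_bigr do rewrite -big_split/=.
    under eq_bigr do rewrite exchange_big/=.
    rewrite exchange_big/=; apply: eq_bigr => i _.
    under eq_bigr do rewrite exchange_big/=.
    by rewrite exchange_big.
  rewrite -sumrN mulr_sumr; apply: ler_sum => i _.
  rewrite -sumrN mulr_sumr; apply: ler_sum => j _.
  exact: second_diff_ge_near.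
have up : \sum_(a < p) \sum_(b < q) (P a b + Q a b) <= (p * q)%:R * (2 * B).
  apply: (@le_trans _ _ (\sum_(a < p) \sum_(b < q) 2 * B)).
    apply: ler_sum => a _; apply: ler_sum => b _.
    by have := Ple a b; have := Qle a b; lra.
  rewrite !sumr_const !card_ord -mulrnA -(mulr_natl (2 * B)) mulnC; exact: lexx.
lra.
Qed.

(** * Convexity of the extension *)

(** The increments of [W] decrease by at most [B] at each step. *)
Lemma almost_convex_seq (R : realType) (W : nat -> R) (B : R) (N : nat) :
  (forall k, (k.+2 <= 2 * N)%N -> - B <= W k.+2 + W k - 2 * W k.+1) ->
  - (N%:R * N%:R * B) <= W (2 * N)%N + W 0%N - 2 * W N.
Proof.
move=> H.
have incr k j : (k + j < 2 * N)%N ->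
    W k.+1 - W k - j%:R * B <= W (k + j).+1 - W (k + j)%N.
  elim: j => [|j IH] kj; first by rewrite addn0 mul0r subr0.
  rewrite addnS in kj *; have := IH (ltnW kj); have := H (k + j)%N kj.
  by rewrite -(natr1 j); lra.
have E : W (2 * N)%N + W 0%N - 2 * W N =
   \sum_(0 <= k < N) ((W (k.+1 + N)%N - W (k + N)%N) - (W k.+1 - W k)).
  rewrite sumrB (telescope_sumr (fun k => W (k + N)%N))// telescope_sumr//.
  by rewrite add0n addnn mul2n; ring.
rewrite E (_ : - _ = \sum_(0 <= k < N) - (N%:R * B)); last first.
  by rewrite big_mkord sumr_const card_ord -mulr_natl; ring.
rewrite !big_mkord; apply: ler_sum => k _.
have := @incr k N; rewrite mul2n -addnn ltn_add2r => /(_ (ltn_ord k)).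
by rewrite addSn; lra.
Qed.

Lemma geometric_small (R : realType) (C e : R) (m : nat) : 0 < e ->
  exists2 n, (m <= n)%N & C * (5 ^+ n * (6 ^+ n)^-1) < e.
Proof.
move=> e0; have : `|5 / 6 : R| < 1 by rewrite ger0_norm; lra.
move=> /(@cvg_geometric R C)/cvgrPdist_lt/(_ _ e0)[M _ HM].
exists (maxn m M); first exact: leq_maxl.
have := HM (maxn m M) (leq_maxr _ _).
rewrite /geometric/= sub0r normrN expr_div_n; exact: le_lt_trans (ler_norm _).
Qed.

(** Approximate the step by [(U, V) = 6^-m (p, +-q)], which is [N] times a vector of the
lattice of mesh [h = 6^-n], with [N = 6^(n - m)]. The sums [W k] of [F] over an [N x N]
window translated along [(U, V)] are convex up to the error [B] of one window, so the
[N^2] second differences with step [(U, V)] have sum at least [- N^2 B]. One of them is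
at least [- B], and [B] tends to 0 with [n] while the window has side [6^-m]. *)
Lemma second_diff_approx (R : realType) (F : R -> R -> R) (u v x y e : R) :
  axes_convex F -> convex_missing_square F -> lip_on_boxes F -> 0 <= u -> 0 < e < 1 ->
  exists u' v' x' y',
     [/\ `|u' - u| <= e, `|v' - v| <= e, `|x' - x| <= e & `|y' - y| <= e] /\
     - e <= second_diff F u' v' x' y'.
Proof.
move=> conv miss lipF u0 /andP[e0 e1].
have [m me] := exists_pow_lt e0; set d := (6 ^+ m)^-1 in me.
have pm0 : 0 < 6 ^+ m :> R by rewrite exprn_gt0.
have pmn0 : 6 ^+ m != 0 :> R by rewrite gt_eqF.
have d0 : 0 < d by rewrite invr_gt0.
pose sg : R := if 0 <= v then 1 else -1.
have sgE : sg = 1 \/ sg = -1 by rewrite /sg; case: ifP; [left|right].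
have vE : v = sg * `|v|.
  rewrite /sg; case: leP => v0; first by rewrite mul1r ger0_norm.
  by rewrite mulN1r ltr0_norm ?opprK.
pose p := Num.truncn (6 ^+ m * u); pose q := Num.truncn (6 ^+ m * `|v|).
have approx (w : R) : 0 <= w -> `|(Num.truncn (6 ^+ m * w))%:R * d - w| <= e.
  move=> w0; have := truncn_itv (mulr_ge0 (ltW pm0) w0); set k := Num.truncn _.
  rewrite -(natr1 k) => /andP[h1 h2].
  have -> : k%:R * d - w = (k%:R - 6 ^+ m * w) * d by rewrite /d; field.
  rewrite normrM (gtr0_norm d0); apply: le_trans (ltW me).
  apply: ler_piMl; first exact: ltW.
  by rewrite ler_norml; apply/andP; split; lra.
pose U := p%:R * d; pose V := sg * (q%:R * d).
have U0 : 0 <= U by rewrite mulr_ge0// ltW.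
have Q0 : 0 <= q%:R * d by rewrite mulr_ge0// ltW.
have Vn : `|V| = q%:R * d.
  by rewrite /V normrM (ger0_norm Q0); case: sgE => ->; rewrite ?normrN normr1 mul1r.
have Uu : `|U - u| <= e by exact: approx.
have Vv : `|V - v| <= e.
  rewrite {1}vE /V -mulrBr normrM; have := approx _ (normr_ge0 v).
  by case: sgE => ->; rewrite ?normrN normr1 mul1r.
pose r := `|x| + `|y| + 3 * U + 3 * (q%:R * d) + 20.
have nx := normr_ge0 x; have ny := normr_ge0 y.
have [|L L0 lip] := lipF r; first by rewrite /r; lra.
pose C := (p * q)%:R * (2 * (p + q)%:R + 2) * (4 * L).
have [n mn small] := geometric_small C m e0.
pose h : R := (6 ^+ n)^-1; pose N := (6 ^ (n - m))%N.
have N0 : (0 < N)%N by rewrite expn_gt0.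
have NR1 : 1 <= N%:R :> R by rewrite ler1n.
have h0 : 0 < h by rewrite invr_gt0 exprn_gt0.
have Nh : N%:R * h = d.
  rewrite /N natrX /h -{2}(subnK mn) exprD /d; field.
  by rewrite pmn0 expf_neq0.
have h1 : h <= d by rewrite -Nh ler_peMl// ltW.
have ph : p%:R * h <= U by rewrite /U ler_wpM2l.
have qh : q%:R * h <= q%:R * d by rewrite ler_wpM2l.
have ph0 : 0 <= p%:R * h by rewrite mulr_ge0// ltW.
have qh0 : 0 <= q%:R * h by rewrite mulr_ge0// ltW.
pose B := (p * q)%:R * (5 ^+ n * (2 * (p + q)%:R + 2) * (4 * h * L)).
have BE : B < e.
  by rewrite (_ : B = C * (5 ^+ n * (6 ^+ n)^-1))// /B /C /h; ring.
suff [i [j [iN jN hij]]] : exists i j : nat,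
    [/\ (i < N)%N, (j < N)%N & - e <= second_diff F U V (x + i%:R * h) (y + j%:R * h)].
  have off k z : (k < N)%N -> `|z + k%:R * h - z| <= e.
    move=> kN; rewrite addrC addKr ger0_norm ?mulr_ge0// ?ltW//.
    apply: le_lt_trans me; rewrite -Nh; apply: ler_wpM2r; first exact: ltW.
    by rewrite ler_nat ltnW.
  by exists U, V, (x + i%:R * h), (y + j%:R * h); split => //; split => //; apply: off.
apply: contrapT => none.
have neg (i j : 'I_N) : second_diff F U V (x + i%:R * h) (y + j%:R * h) <= - e.
  rewrite leNgt; apply/negP => lt; apply: none; exists i, j.
  by split; rewrite ?ltn_ord// ltW.
pose W (k : nat) := \sum_(i < N) \sum_(j < N)
  F (x - U + k%:R * (p%:R * h) + i%:R * h) (y - V + k%:R * (sg * (q%:R * h)) + j%:R * h).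
have WB k : (k.+2 <= 2 * N)%N -> - B <= W k.+2 + W k - 2 * W k.+1.
  move=> kN.
  have := @window_sum R F n N p q h L r (x - U + k.+1%:R * (p%:R * h))
    (y - V + k.+1%:R * (sg * (q%:R * h))) sg conv miss sgE erefl L0 lip.
  rewrite -/B => ws; apply: le_trans (ws _) _; last first.
    rewrite /W mulr_sumr -big_split/= -sumrB; apply: ler_sum => i _.
    rewrite mulr_sumr -big_split/= -sumrB; apply: ler_sum => j _.
    rewrite /second_diff -(natr1 k.+1) -(natr1 k).
    have -> : x - U + (k%:R + 1 + 1) * (p%:R * h) + i%:R * h =
      x - U + (k%:R + 1) * (p%:R * h) + i%:R * h + p%:R * h by ring.
    have -> : y - V + (k%:R + 1 + 1) * (sg * (q%:R * h)) + j%:R * h =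
      y - V + (k%:R + 1) * (sg * (q%:R * h)) + j%:R * h + sg * (q%:R * h) by ring.
    have -> : x - U + k%:R * (p%:R * h) + i%:R * h =
      x - U + (k%:R + 1) * (p%:R * h) + i%:R * h - p%:R * h by ring.
    have -> : y - V + k%:R * (sg * (q%:R * h)) + j%:R * h =
      y - V + (k%:R + 1) * (sg * (q%:R * h)) + j%:R * h - sg * (q%:R * h) by ring.
    exact: lexx.
  have kle : k.+1%:R <= 2 * N%:R :> R by rewrite -natrM ler_nat ltnW.
  have k1h w : 0 <= w -> 0 <= k.+1%:R * (w * h) <= 2 * (w * d).
    move=> w0; have wh0 : 0 <= w * h by rewrite mulr_ge0// ltW.
    rewrite mulr_ge0//= (_ : 2 * (w * d) = 2 * N%:R * (w * h)); first by rewrite ler_wpM2r.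
    by rewrite -Nh; ring.
  have X1 : `|x - U + k.+1%:R * (p%:R * h)| <= `|x| + U.
    rewrite -addrA; apply: le_trans (ler_normD _ _) _; rewrite lerD2l ler_norml.
    by have := k1h p%:R (ler0n _ _); rewrite -/U => /andP[? ?]; apply/andP; split; lra.
  have Y1 : `|y - V + k.+1%:R * (sg * (q%:R * h))| <= `|y| + q%:R * d.
    rewrite -addrA; apply: le_trans (ler_normD _ _) _; rewrite lerD2l.
    rewrite (_ : - V + _ = sg * (- (q%:R * d) + k.+1%:R * (q%:R * h))); last first.
      by rewrite /V; ring.
    have := k1h q%:R (ler0n _ _) => /andP[? ?].
    rewrite normrM (_ : `|sg| = 1) ?mul1r; last first.
      by case: sgE => ->; rewrite ?normrN normr1.
    by rewrite ler_norml; apply/andP; split; lra.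
  rewrite /r; lra.
have := almost_convex_seq WB.
have -> : W (2 * N)%N + W 0%N - 2 * W N =
   \sum_(i < N) \sum_(j < N) second_diff F U V (x + i%:R * h) (y + j%:R * h).
  rewrite /W mulr_sumr -big_split/= -sumrB; apply: eq_bigr => i _.
  rewrite mulr_sumr -big_split/= -sumrB; apply: eq_bigr => j _.
  rewrite /second_diff natrM.
  have UN : N%:R * (p%:R * h) = U by rewrite /U -Nh; ring.
  have VN : N%:R * (sg * (q%:R * h)) = V by rewrite /V -Nh; ring.
  have -> : x - U + 2 * N%:R * (p%:R * h) + i%:R * h = x + i%:R * h + U.
    by rewrite -UN; ring.
  have -> : y - V + 2 * N%:R * (sg * (q%:R * h)) + j%:R * h = y + j%:R * h + V.
    by rewrite -VN; ring.
  rewrite UN VN !mul0r !addr0 !subrK.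
  by rewrite ![_ - _ + _ * h]addrAC.
apply/negP; rewrite -ltNge.
apply: (@le_lt_trans _ _ (\sum_(i < N) \sum_(j < N) - e)).
  by apply: ler_sum => i _; apply: ler_sum => j _; exact: neg.
rewrite !sumr_const !card_ord -mulrnA -(mulr_natr (- e)) mulNr natrM ltrN2.
by rewrite (mulrC e) ltr_pM2l// mulr_gt0; lra.
Qed.

Lemma second_diff_ge0 (R : realType) (F : R -> R -> R) (u v x y : R) :
  axes_convex F -> convex_missing_square F -> lip_on_boxes F ->
  0 <= second_diff F u v x y.
Proof.
move=> conv miss lipF.
have key u' v' : 0 <= u' -> 0 <= second_diff F u' v' x y.
  move=> u0; apply: second_diff_limit => // e e01.
  exact: second_diff_approx.
have [u0|u0] := leP 0 u; first exact: key.
by rewrite -second_diffN; apply: key; rewrite oppr_ge0 ltW.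
Qed.

Lemma extension_missing (R : realType) (g F : R -> R -> R) :
  convex_off_square g -> (forall x y, ~ in_square x y -> F x y = g x y) ->
  convex_missing_square F.
Proof.
move=> H Fg u v x y off.
have F0 t : -1 <= t <= 1 -> F (x + t * u) (y + t * v) = g (x + t * u) (y + t * v).
  by move=> /off/Fg.
have := F0 1 (ltac:(lra)); have := F0 0 (ltac:(lra)); have := F0 (-1) (ltac:(lra)).
rewrite !mulN1r !mul1r !mul0r !addr0 /second_diff => -> -> ->.
by have := midpoint_off_square H off; lra.
Qed.

(** Each of the four directions has a dense set of parallel lines that miss the square:
those on which [y], [x], [x - y] or [x + y] avoids the Cantor set with digits
{-2, ..., 2}. *)
Lemma extension_axes (R : realType) (F : R -> R -> R) :
  lip_on_boxes F -> convex_missing_square F -> axes_convex F.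
Proof.
move=> lipF miss s x y.
have lim u v : (forall e : R, 0 < e < 1 -> exists x' y',
      [/\ `|x' - x| <= e, `|y' - y| <= e & forall t, ~ in_square (x' + t * u) (y' + t * v)]) ->
    0 <= second_diff F u v x y.
  move=> H; apply: second_diff_limit => // e e01.
  have [x' [y' [dx dy off]]] := H e e01; have /andP[e0 e1] := e01.
  exists u, v, x', y'; rewrite !subrr normr0 ltW//; split => //.
  by apply: (@le_trans _ _ 0); [lra|apply: miss].
have shift z (e : R) : 0 < e < 1 -> exists2 c, `|c| <= e & ~ cantor_set 2 (z + c).
  move=> /andP[e0 _]; have [c ce Cc] := cantor_set_dense z e0.
  by exists (c - z); [exact: ltW|rewrite addrC subrK].
split; apply: lim => e e01; have /andP[/ltW e0 _] := e01.
- have [c ce Cc] := shift y e e01; exists x, (y + c); split.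
  + by rewrite subrr normr0.
  + by rewrite addrC addKr.
  + by move=> t [_]; rewrite mulr0 addr0 => C1; apply: Cc => n; exact: cantor12.
- have [c ce Cc] := shift x e e01; exists (x + c), y; split.
  + by rewrite addrC addKr.
  + by rewrite subrr normr0.
  + by move=> t [+ _]; rewrite mulr0 addr0 => C1; apply: Cc => n; exact: cantor12.
- have [c ce Cc] := shift (x - y) e e01; exists (x + c), y; split.
  + by rewrite addrC addKr.
  + by rewrite subrr normr0.
  + move=> t [Cx Cy]; apply: Cc => n.
    rewrite (_ : x - y + c = x + c + t * s - (y + t * s)); last by ring.
    exact: cantorD (Cx n) (cantorN (Cy n)).
- have [c ce Cc] := shift (x + y) e e01; exists (x + c), y; split.
  + by rewrite addrC addKr.
  + by rewrite subrr normr0.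
  + move=> t [Cx Cy]; apply: Cc => n.
    rewrite (_ : x + y + c = x + c + t * s + (y + t * - s)); last by ring.
    exact: cantorD (Cx n) (Cy n).
Qed.

(** Continuity and midpoint convexity on the line through the two points. *)
Lemma convex_of_second_diff (R : realType) (F : R -> R -> R) :
  lip_on_boxes F -> (forall u v x y, 0 <= second_diff F u v x y) ->
  forall x1 y1 x2 y2 t : R, 0 <= t <= 1 ->
  F ((1 - t) * x1 + t * x2) ((1 - t) * y1 + t * y2) <= (1 - t) * F x1 y1 + t * F x2 y2.
Proof.
move=> lipF D2 x1 y1 x2 y2 t t01.
pose u := x2 - x1; pose v := y2 - y1.
pose phi s := F (x1 + s * u) (y1 + s * v).
have : convex_between phi 0 1.
  apply: convex_of_midpoints => [s /andP[s0 s1]|s _]; last first.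
    exists 1 => // k _; have := D2 (k * u) (k * v) (x1 + s * u) (y1 + s * v).
    by rewrite /second_diff /phi !mulrDl !mulNr !addrA; lra.
  have nx := normr_ge0 x1; have ny := normr_ge0 y1.
  have nu := normr_ge0 u; have nv := normr_ge0 v.
  pose r := `|x1| + `|y1| + 2 * `|u| + 2 * `|v|.
  have [|L L0 lip] := lipF r; first by rewrite /r; lra.
  apply: (@continuous_of_lip _ _ _ 1 (L * (`|u| + `|v|))) => // s' ss'.
  have bd (s'' : R) : `|s''| <= 2 -> `|x1 + s'' * u| <= r /\ `|y1 + s'' * v| <= r.
    move=> s2; have hu : `|s'' * u| <= 2 * `|u| by rewrite normrM ler_wpM2r.
    have hv : `|s'' * v| <= 2 * `|v| by rewrite normrM ler_wpM2r.
    split; apply: le_trans (ler_normD _ _) _; rewrite /r; lra.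
  have [a1 a2] := bd s (ltac:(rewrite ger0_norm//; lra)).
  have s'2 : `|s'| <= 2.
    have -> : s' = s' - s + s by rewrite subrK.
    apply: le_trans (ler_normD _ _) _; rewrite (ger0_norm s0); lra.
  have [b1 b2] := bd s' s'2.
  rewrite /phi; apply: le_trans (lip _ _ _ _ b1 b2 a1 a2) _.
  have -> : x1 + s' * u - (x1 + s * u) = u * (s' - s) by ring.
  have -> : y1 + s' * v - (y1 + s * v) = v * (s' - s) by ring.
  by rewrite !normrM -mulrDl mulrA.
move=> /(_ 0 1 t); rewrite !lexx !ler01 => /(_ isT isT t01).
rewrite /phi mulr0 add0r mulr1 !mul0r !addr0 !mul1r /u /v.
rewrite [x1 + (x2 - x1)]addrC subrK [y1 + (y2 - y1)]addrC subrK.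
congr (F _ _ <= _); ring.
Qed.

(** * The theorem *)

Definition point (R : realType) (x y : R) : 'rV[R]_2 := \row_i (if i == 0 then x else y).

Lemma pointE (R : realType) (v : 'rV[R]_2) : point (v 0 0) (v 0 1) = v.
Proof.
apply/rowP => i; rewrite mxE; case: i => -[|[|//]] hi /=; congr (v _ _);
  exact/val_inj.
Qed.

Lemma point_conv (R : realType) (x1 y1 x2 y2 t : R) :
  t *: point x1 y1 + (1 - t) *: point x2 y2 =
  point (t * x1 + (1 - t) * x2) (t * y1 + (1 - t) * y2).
Proof. by apply/rowP => i; rewrite !mxE; case: ifP. Qed.

Lemma cantor_squareP (R : realType) (x y : R) :
  cantor_square (point x y) <-> in_square x y.
Proof.
split=> [h|[Cx Cy] i]; first by split; [have := h 0 | have := h 1]; rewrite mxE.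
by rewrite mxE; case: ifP.
Qed.

Lemma point_norm_lt (R : realType) (x y e : R) : 0 < e ->
  `|x| < e -> `|y| < e -> `|point x y| < e.
Proof.
move=> e0 xe ye; rewrite /Num.norm/= mx_normrE; apply/bigmax_ltP; split => // i _.
by rewrite mxE; case: ifP.
Qed.

Lemma locally_convex_off (R : realType) (f : 'rV[R]_2 -> R) :
  locally_convex_on (~` @cantor_square R) f ->
  convex_off_square (fun x y => f (point x y)).
Proof.
move=> H x y sq; have [|V [oV cV Vxy VK convf]] := H (point x y).
  by move=> /cantor_squareP.
have /nbhs_ballP[e /= e0 ball_e] : nbhs (point x y) V by exact: open_nbhs_nbhs.
have inV x' y' : `|x' - x| < e -> `|y' - y| < e -> V (point x' y').
  move=> dx dy; apply: ball_e; rewrite -ball_normE/= distrC.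
  rewrite (_ : _ - _ = point (x' - x) (y' - y)); first exact: point_norm_lt.
  by apply/rowP => i; rewrite !mxE; case: ifP.
exists e => // x1 y1 x2 y2 l dx1 dy1 dx2 dy2 /andP[l0 l1].
have l0' : 0 <= 1 - l by rewrite subr_ge0.
have l1' : 1 - l <= 1 by lra.
have i01 : Itv.spec (@Itv.num_sem R) (Itv.Real `[0%Z, 1%Z]) (1 - l).
  by rewrite /Itv.spec/= /Itv.num_sem/= in_itv/= l0' l1' ger0_real.
have := convf (Itv.Def i01) (point x1 y1) (point x2 y2).
rewrite !inE => /(_ (inV _ _ dx1 dy1) (inV _ _ dx2 dy2)).
rewrite convRE /conv/= /unstable.onem subKr.
have := point_conv x1 y1 x2 y2 (1 - l); rewrite subKr => ->.
exact.
Qed.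

Theorem mainTheorem4 (R : realType) :
  exists K : set 'rV[R]_2,
    [/\ compact K,
        ~ intervally_thin K &
        forall f : 'rV[R]_2 -> R, locally_convex_on (~` K) f ->
          exists F : 'rV[R]_2 -> R,
            convex_function [set: 'rV[R]_2] F /\
            (forall x : 'rV[R]_2, ~ K x -> F x = f x)].
Proof.
exists (@cantor_square R); split.
- exact: compact_cantor_square.
- exact: not_thin_cantor_square.
move=> f /locally_convex_off H.
have [F lipF Fg] := extend_to_square H.
have miss := extension_missing H Fg.
have conv := extension_axes lipF miss.
have cvx := convex_of_second_diff lipF (fun u v x y => second_diff_ge0 u v x y conv miss lipF).
exists (fun v => F (v 0 0) (v 0 1)); split; last first.
  move=> v Kv; rewrite -{3}(pointE v); apply: Fg => sq; apply: Kv.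
  by rewrite -(pointE v); apply/cantor_squareP.
move=> t v w _ _; rewrite convRE /conv/= /unstable.onem !mxE.
have t0 : 0 <= t%:num by [].
have t1 : t%:num <= 1 by [].
have := cvx (v 0 0) (v 0 1) (w 0 0) (w 0 1) (1 - t%:num) (ltac:(lra)).
by rewrite subKr.
Qed.
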